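(* Assume that $\zeta\to0$. Then all tests are asymptotically powerless in any of the following situations: (1) $\lambda_0\to0$, $\lambda_1\to0$, and $\displaystyle\limsup\frac{I_{\lambda_0}}{I_{\lambda_1}}\frac{\log n}{\log N}<1$; (2) $0<\liminf\lambda_0\le\limsup\lambda_0<\infty$ and $\lambda_1\to0$; (3) $\lambda_0\to\infty$ with $\alpha\to0$, and $\limsup\lambda_1<1$; (4) $0<\liminf\alpha\le\limsup\alpha<1$ and $\displaystyle\limsup\ (1-\alpha)\sup_{k=n/u_N}^{n}\frac{\mathbb{E}_S[W_{k,S}^*]}{k}<1$.
   Context: Setting. We observe an undirected simple graph $\mathcal{G}$ on the node set $\mathcal{V}=\{1,\dots,N\}$ with adjacency matrix $(W_{i,j})$ (symmetric, $0/1$, zero diagonal). Under the null hypothesis, with distribution $\mathbb{P}_0$, $\mathcal{G}$ is an Erdős–Rényi graph $\mathbb{G}(N,p_0)$, i.e. the $W_{i,j}$, $i<j$, are i.i.d. Bernoulli($p_0$). For $S\subset\mathcal{V}$ with $|S|=n$, under $\mathbb{P}_S$ (expectation $\mathbb{E}_S$) the $W_{i,j}$, $i<j$, are independent with $\mathbb{P}_S(W_{i,j}=1)=p_1$ if $i,j\in S$ and $=p_0$ otherwise, where $p_1>p_0$. The alternative is the union over all $S$ with $|S|=n$. The parameters $n,p_0,p_1$ may depend on $N$; all limits are as $N\to\infty$, with $n\to\infty$, $n/N\to0$, $n/\log N\to\infty$, $N^2p_0\to\infty$, $n^2p_1\to\infty$. Notation. $\lambda_0=Np_0$, $\lambda_1=np_1$,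 $\alpha=\log\lambda_0/\log(N/n)$, $u_N=\log\log(N/n)$, $I_\lambda=\lambda-1-\log\lambda$ for $\lambda>0$, and $$\zeta=\frac{(p_1-p_0)^2}{p_0}\frac{n^4}{N^2}.$$ For $T\subset\mathcal{V}$, $W_T=\sum_{i,j\in T,\,i<j}W_{i,j}$; for $S\subset\mathcal{V}$, $W_{k,S}^*=\max_{T\subset S,\,|T|=k}W_T$; $\sup_{k=n/u_N}^n$ means the supremum over integers $k$ with $n/u_N\le k\le n$. The quantity $\mathbb{E}_S[W_{k,S}^*]$ with $|S|=n$ does not depend on the choice of $S$. Tests. A test $\phi$ is a $\{0,1\}$-valued function of the adjacency matrix; its risk is $\gamma_N(\phi)=\mathbb{P}_0(\phi=1)+\max_{|S|=n}\mathbb{P}_S(\phi=0)$. ''All tests are asymptotically powerless'' means that $\gamma_N^*:=\inf_\phi\gamma_N(\phi)\to1$, the infimum being over all tests. *)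

(* Defs.v *)
From HB Require Import structures.
From mathcomp Require Import all_boot all_order all_algebra.
From mathcomp Require Import all_classical all_reals all_analysis.

Set Implicit Arguments.
Unset Strict Implicit.
Unset Printing Implicit Defensive.

Import Order.TTheory GRing.Theory Num.Theory.

Local Open Scope ring_scope.

Definition is_adjacency (N : nat) (W : 'M[bool]_N) : bool :=
  [forall i, forall j, W i j == W j i] && [forall i, ~~ W i i].

Record sgraph (N : nat) := SGraph {
  adj : 'M[bool]_N;
  adjP : is_adjacency adj }.

HB.instance Definition _ (N : nat) := [isSub for @adj N].
HB.instance Definition _ (N : nat) := [Finite of sgraph N by <:].

(* Joint law of independent edge indicators: the product over the unordered
   pairs {i, j}, listed with i < j, of Bernoulli (q i j) mass functions. *)
Definition graph_law (R : realType) (N : nat) (q : 'I_N -> 'I_N -> R)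
    (G : sgraph N) : R :=
  \prod_(i < N) \prod_(j < N | (i < j)%N) bernoulli_pmf (q i j) (adj G i j).

Definition Pr (T : finType) (R : realType) (mu : T -> R) (A : pred T) : R :=
  \sum_(x | A x) mu x.

Definition Ex (T : finType) (R : realType) (mu : T -> R) (X : T -> R) : R :=
  \sum_x mu x * X x.

Definition null_law (R : realType) (N : nat) (p0 : R) : sgraph N -> R :=
  graph_law (fun _ _ => p0).

Definition planted_law (R : realType) (N : nat) (p0 p1 : R) (S : {set 'I_N}) :
    sgraph N -> R :=
  graph_law (fun i j => if (i \in S) && (j \in S) then p1 else p0).

Definition test (N : nat) := sgraph N -> bool.

(* The default value 0 of the maximum is immaterial as soon as n <= N and
   p0, p1 lie in [0, 1]. *)
Definition risk (R : realType) (N n : nat) (p0 p1 : R) (phi : test N) : R :=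
  Pr (null_law p0) (fun G => phi G) +
  \big[Num.max/0]_(S : {set 'I_N} | #|S| == n)
    Pr (planted_law p0 p1 S) (fun G => ~~ phi G).

Definition minimax_risk (R : realType) (N n : nat) (p0 p1 : R) : R :=
  inf (range (fun phi : test N => risk n p0 p1 phi)).

Definition edges_in (N : nat) (G : sgraph N) (T : {set 'I_N}) : nat :=
  (\sum_(i in T) \sum_(j in T | (i < j)%N) adj G i j)%N.

Definition max_edges_in (N : nat) (k : nat) (S : {set 'I_N}) (G : sgraph N) :
    nat :=
  (\max_(T : {set 'I_N} | (T \subset S) && (#|T| == k)) edges_in G T)%N.

Definition rate_I (R : realType) (l : R) : R := l - 1 - ln l.

Definition ratio (R : realType) (N n : nat) : R := N%:R / n%:R.

(* Where N * p0 <= 0 or N = n, the conventions ln x = 0 for x <= 0 and 0^-1 = 0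
   apply; the statement only uses large N, for which neither occurs. *)
Definition log_ratio_exponent (R : realType) (N n : nat) (p0 : R) : R :=
  ln (N%:R * p0) / ln (ratio R N n).

Definition loglog_ratio (R : realType) (N n : nat) : R :=
  ln (ln (ratio R N n)).

Definition zeta (R : realType) (N n : nat) (p0 p1 : R) : R :=
  (p1 - p0) ^+ 2 / p0 * (n%:R ^+ 4 / N%:R ^+ 2).

(* sup over the integers k with n / u <= k <= n of E_S[W*_{k,S}] / k, where
   u = log log (N / n). The terms are nonnegative, and for all large N one has
   n / u > 0, so that k = 0 does not occur. *)
Definition sup_mean_max_edges (R : realType) (N n : nat) (p0 p1 : R)
    (S : {set 'I_N}) : R :=
  \big[Num.max/0]_(k < n.+1 | n%:R / loglog_ratio R N n <= k%:R)
    (Ex (planted_law p0 p1 S) (fun G => (max_edges_in k S G)%:R) / k%:R).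

(* Main.v *)
(* Put the uniform prior on the sets [S] of size [n] and let [L] be the average
   of the likelihood ratios, each truncated to the event that no [T] in [S] spans
   more than [c #|T|] edges. Every test has risk at least [E0 (min 1 L)], which
   tends to 1 once the truncation event has planted probability tending to 1 and
   [E0 (L ^ 2) <= 1 + o(1)]. By independence the second moment only involves
   [k = #|S :&: T|] for two independent sets of the prior, and
   [P (#|S :&: T| = k) <= rho ^ k / k!] with [rho = n ^ 2 / N]. For [k] of order
   at most [rho], the untruncated bound and [zeta -> 0] suffice. For larger [k],
   an exponential tilt reduces the matter to the smallness of
   [rho / k * (D k) ^ c], where [D = p1 ^ 2 / p0]. It remains to choose [c]:
   - for [lambda1] bounded away from 1 (cases 2 and 3), [c = 1]: a graph with more
     edges than vertices contains a path with two chords, and such paths are rare;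
   - in case 1, [c < 1] by a union bound over the sets [T];
   - in case 4, [c] is slightly above 1 for [#|T| < n / u_N] by a union bound, and
     slightly below [1 / (1 - alpha)] otherwise, by concentration of [W*_{k,S}]
     (the Efron-Stein inequality bounds its variance by its mean). *)
Require Import Defs.
From mathcomp Require Import all_boot all_order all_algebra fingroup perm.
From mathcomp Require Import all_classical all_reals all_analysis.
From mathcomp Require Import zify ring lra.

Set Implicit Arguments.
Unset Strict Implicit.
Unset Printing Implicit Defensive.

Import Order.TTheory GRing.Theory Num.Theory numFieldNormedType.Exports.

Local Open Scope ring_scope.

(** * Independent edges *)

(** The choice of [c] is read off two exponents. One has [rho / k = (n / N) (n / k)] and [D k =
    (lambda1 ^ 2 / lambda0) (N / n) (k / n)], while a union bound over the sets of size [k] has base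
    [e^(3/2) (n / k)^(1 - c) lambda1^c]. For [c = 1] the product [(rho / k) (D k)] equals
    [lambda1 ^ 2 / lambda0] whatever [k] is, but the union bound base is then [e^(3/2) lambda1],
    which is useless when [lambda1] merely stays below 1. Counting paths instead of sets removes the
    constant, and the two chords leave a spare factor [p1]. In case 4, [D k] is at most a constant
    times [(N / n)^(1 - alpha)], so [c] has to stay below [1 / (1 - alpha)]. The union bound needs
    both [c > 1] and [n / k] large, hence the threshold [n / u_N]: above it, [n / k <= u_N] is
    negligible against any power of [N / n], and the level can be placed just above the expected
    maximum. All error terms are bases raised to the power [k], so one small base controls the sum
    over [k] by a geometric series. *)

Notation edge N := {e : 'I_N * 'I_N | (e.1 < e.2)%N}.

Section EdgeVectors.
Variables (R : realType) (N : nat).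
Implicit Types (q : 'I_N -> 'I_N -> R) (x : {ffun edge N -> bool}) (G : sgraph N).

Lemma prod_pairs (F : 'I_N -> 'I_N -> R) :
  \prod_(i < N) \prod_(j < N | (i < j)%N) F i j =
  \prod_(e : edge N) F (val e).1 (val e).2.
Proof.
rewrite pair_big_dep /=.
by rewrite -(big_sub (fun e : 'I_N * 'I_N => (e.1 < e.2)%N) (fun e => F e.1 e.2)).
Qed.

Definition pair_val x (i j : 'I_N) : bool :=
  if insub (i, j) is Some e then x e else false.

Definition mx_of x : 'M[bool]_N := \matrix_(i, j) (pair_val x i j || pair_val x j i).

Lemma mx_of_adjacency x : is_adjacency (mx_of x).
Proof.
apply/andP; split.
  by apply/forallP => i; apply/forallP => j; rewrite !mxE orbC.
by apply/forallP => i; rewrite !mxE /pair_val insubF //= ltnn.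
Qed.

Definition graph_of x : sgraph N := SGraph (mx_of_adjacency x).

Definition edges_of G : {ffun edge N -> bool} :=
  [ffun e : edge N => adj G (val e).1 (val e).2].

Lemma adjC G i j : adj G i j = adj G j i.
Proof. by have /andP[/forallP/(_ i)/forallP/(_ j)/eqP] := adjP G. Qed.

Lemma adjii G i : adj G i i = false.
Proof. by have /andP[_ /forallP/(_ i)/negbTE] := adjP G. Qed.

Lemma adj_graph_of x (e : edge N) : adj (graph_of x) (val e).1 (val e).2 = x e.
Proof.
rewrite mxE /pair_val -surjective_pairing valK [insub (_, (val e).1)]insubF ?orbF //=.
by apply/negbTE; rewrite -leqNgt ltnW // (valP e).
Qed.

Lemma graph_ofK : cancel graph_of edges_of.
Proof. by move=> x; apply/ffunP => e; rewrite ffunE adj_graph_of. Qed.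

Lemma adj_inj G H : (forall i j : 'I_N, (i < j)%N -> adj G i j = adj H i j) -> G = H.
Proof.
move=> eGH; apply: val_inj; apply/matrixP => i j /=.
case: (ltngtP i j) => [/eGH//|/eGH|/val_inj <-]; last by rewrite !adjii.
by rewrite adjC [in RHS]adjC.
Qed.

Lemma edges_ofK : cancel edges_of graph_of.
Proof.
move=> G; apply: adj_inj => i j ltij.
by have := adj_graph_of (edges_of G) (Sub (i, j) ltij); rewrite ffunE /=.
Qed.

Definition edge_law q x : R := \prod_(e : edge N) bernoulli_pmf (q (val e).1 (val e).2) (x e).

Lemma graph_lawE q x : graph_law q (graph_of x) = edge_law q x.
Proof.
by rewrite /graph_law prod_pairs; apply: eq_bigr => e _; rewrite adj_graph_of.
Qed.

Lemma Ex_graph_law q (f : sgraph N -> R) :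
  Ex (graph_law q) f = \sum_x edge_law q x * f (graph_of x).
Proof.
rewrite /Ex (reindex graph_of) /=; last first.
  by exists edges_of => ? _; rewrite ?graph_ofK ?edges_ofK.
by apply: eq_bigr => x _; rewrite graph_lawE.
Qed.

(** The form in which independence is used: exponential moments, likelihood ratios and path
    indicators are all products of functions of single edges. *)
Lemma Ex_prod q (g : 'I_N -> 'I_N -> bool -> R) :
  Ex (graph_law q) (fun G => \prod_(i < N) \prod_(j < N | (i < j)%N) g i j (adj G i j)) =
  \prod_(i < N) \prod_(j < N | (i < j)%N)
    (q i j * g i j true + (1 - q i j) * g i j false).
Proof.
rewrite Ex_graph_law [RHS]prod_pairs.
under [RHS]eq_bigr => e _.
  rewrite (_ : _ + _ = \sum_(b : bool) bernoulli_pmf (q (val e).1 (val e).2) b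
     * g (val e).1 (val e).2 b); last by rewrite big_bool.
  over.
rewrite bigA_distr_bigA /=; apply: eq_bigr => x _.
rewrite prod_pairs /edge_law -big_split /=; apply: eq_bigr => e _.
by rewrite adj_graph_of.
Qed.

Lemma graph_law_ge0 q G : (forall i j, 0 <= q i j <= 1) -> 0 <= graph_law q G.
Proof.
move=> hq; apply: prodr_ge0 => i _; apply: prodr_ge0 => j _.
exact: bernoulli_pmf_ge0.
Qed.

Lemma graph_law_sum q : \sum_G graph_law q G = 1.
Proof.
transitivity (Ex (graph_law q) (fun G => \prod_(i < N) \prod_(j < N | (i < j)%N)
   ((fun _ _ _ => 1) i j (adj G i j)))).
  apply: eq_bigr => G _; rewrite big1 ?mulr1 // => i _.
  by rewrite big1.
rewrite (Ex_prod q (fun _ _ _ => 1)) big1 // => i _; rewrite big1 // => j _; ring.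
Qed.

End EdgeVectors.

(** * Elementary probability on a finite space *)

Section Expectations.
Variables (R : realType) (T : finType) (mu : T -> R).
Hypothesis mu_ge0 : forall x, 0 <= mu x.

Lemma Ex_le (f g : T -> R) : (forall x, f x <= g x) -> Ex mu f <= Ex mu g.
Proof. by move=> fg; apply: ler_sum => x _; apply: ler_wpM2l. Qed.

Lemma ExD (f g : T -> R) : Ex mu (fun x => f x + g x) = Ex mu f + Ex mu g.
Proof. by rewrite /Ex -big_split /=; apply: eq_bigr => x _; rewrite mulrDr. Qed.

Lemma ExZ a (f : T -> R) : Ex mu (fun x => a * f x) = a * Ex mu f.
Proof. by rewrite /Ex big_distrr; apply: eq_bigr => x _; rewrite /= mulrCA. Qed.

Lemma Ex_sum (I : finType) (P : pred I) (f : I -> T -> R) :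
  Ex mu (fun x => \sum_(i | P i) f i x) = \sum_(i | P i) Ex mu (f i).
Proof.
by rewrite /Ex exchange_big /=; apply: eq_bigr => x _; rewrite big_distrr.
Qed.

Lemma PrE (A : pred T) : Pr mu A = Ex mu (fun x => (A x)%:R).
Proof.
rewrite /Pr /Ex big_mkcond /=; apply: eq_bigr => x _.
by case: (A x); rewrite ?mulr1 ?mulr0.
Qed.

Lemma Pr_le_Ex (A : pred T) (f : T -> R) :
  (forall x, 0 <= f x) -> (forall x, A x -> 1 <= f x) -> Pr mu A <= Ex mu f.
Proof.
move=> f0 f1; rewrite PrE; apply: Ex_le => x.
by case: (boolP (A x)) => [/f1//|_]; apply: f0.
Qed.

Lemma Pr_sub (A B : pred T) : (forall x, A x -> B x) -> Pr mu A <= Pr mu B.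
Proof.
move=> AB; rewrite !PrE; apply: Ex_le => x.
by case: (boolP (A x)) => [/AB->|_] //; case: (B x).
Qed.

Lemma Pr_exists (I : finType) (P : pred I) (A : pred T) (B : I -> pred T) :
  (forall x, A x -> exists2 i, P i & B i x) ->
  Pr mu A <= \sum_(i | P i) Pr mu (B i).
Proof.
move=> AB; under eq_bigr => i _ do rewrite PrE.
rewrite -Ex_sum; apply: Pr_le_Ex => x; first exact: sumr_ge0.
by case/AB => i Pi Bi; rewrite (bigD1 i) //= Bi lerDl sumr_ge0.
Qed.

Lemma Pr_or (A B C : pred T) :
  (forall x, A x -> B x \/ C x) -> Pr mu A <= Pr mu B + Pr mu C.
Proof.
move=> ABC; rewrite !PrE -ExD; apply: Ex_le => x.
case: (boolP (A x)) => [/ABC|_]; last by rewrite addr_ge0.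
by case=> ->; rewrite ?lerDl ?lerDr.
Qed.

Hypothesis mu_sum : \sum_x mu x = 1.

Lemma Ex_cst a : Ex mu (fun=> a) = a.
Proof. by rewrite /Ex -big_distrl /= mu_sum mul1r. Qed.

Lemma Pr_le1 (A : pred T) : Pr mu A <= 1.
Proof.
rewrite PrE -[leRHS](Ex_cst 1); apply: Ex_le => x.
by case: (A x).
Qed.

Lemma Pr_compl (A : pred T) : Pr mu (fun x => ~~ A x) = 1 - Pr mu A.
Proof.
apply/eqP; rewrite eq_sym subr_eq !PrE -ExD -[X in X == _](Ex_cst 1); apply/eqP.
by apply: eq_bigr => x _; case: (A x); rewrite /= ?addr0 ?add0r.
Qed.

Lemma chebyshev_upper (f : T -> R) (m t : R) : 0 < t -> Ex mu f = m ->
  Pr mu (fun x => m + t <= f x) <= (Ex mu (fun x => f x ^+ 2) - m ^+ 2) / t ^+ 2.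
Proof.
move=> t0 fm.
apply: (@le_trans _ _ (Ex mu (fun x => t ^- 2 * (f x - m) ^+ 2))).
  apply: Pr_le_Ex => x; first by rewrite mulr_ge0 // ?invr_ge0 ?sqr_ge0.
  move=> h; rewrite mulrC ler_pdivlMr ?exprn_gt0 // mul1r.
  by rewrite lerXn2r ?nnegrE ?(ltW t0) //; lra.
rewrite ExZ mulrC ler_pM2r ?invr_gt0 ?exprn_gt0 //.
have -> : Ex mu (fun x => (f x - m) ^+ 2) =
  Ex mu (fun x => f x ^+ 2 + (- (2 * m) * f x + m ^+ 2)).
  by apply: eq_bigr => x _; congr (_ * _); ring.
rewrite ExD ExD ExZ Ex_cst fm; lra.
Qed.

End Expectations.

(** * Counting bounds for sets, pairs and overlaps *)

Section Combinatorics.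
Variable R : realType.

(** Stirling-type bound, by induction from [(1 + 1/k)^k <= e]. It turns [1 / k!] into [(e / k)^k],
    so that overlap and union bounds become [k]-th powers. *)
Lemma expn_le_fact_expR (k : nat) : k%:R ^+ k <= k`!%:R * expR k%:R :> R.
Proof.
elim: k => [|k IH]; first by rewrite expr0 fact0 mul1r expR0.
case: k IH => [|k] IH.
  by rewrite expr1 mul1r (le_trans _ (expR_ge1Dx 1)) // lerDl.
rewrite exprS factS natrM -mulrA ler_wpM2l //.
have {1}-> : k.+2%:R = (1 + k.+1%:R^-1) * k.+1%:R :> R.
  by rewrite mulrDl mul1r mulVf ?pnatr_eq0 // natr1.
rewrite exprMn.
apply: (@le_trans _ _ (expR (k.+1%:R^-1) ^+ k.+1 * k.+1%:R ^+ k.+1)).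
  rewrite ler_wpM2r ?exprn_ge0 // lerXn2r ?nnegrE ?expR_ge0 ?expR_ge1Dx //.
  rewrite -expRM_natl mulfV ?pnatr_eq0 // -[k.+2%:R]natr1 expRD mulrA [leLHS]mulrC.
by rewrite ler_wpM2r ?expR_ge0.
Qed.

Lemma geometric_tail_le (x : R) (n : nat) : 0 <= x <= 1 / 2 ->
  \sum_(k < n) x ^+ k.+1 <= 2 * x.
Proof.
(* The subtracted term is what makes the induction close. *)
move=> /andP[x0 x1]; apply: (@le_trans _ _ (2 * x - 2 * x ^+ n.+1)); last first.
  by rewrite gerBl mulr_ge0 ?exprn_ge0.
elim: n => [|n IH]; first by rewrite big_ord0 expr1 subrr.
rewrite big_ord_recr /=.
have := exprn_ge0 n.+1 x0; rewrite ![x ^+ n.+2]exprS => y0.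
move: IH y0; set y := x ^+ n.+1; move: y => y IH y0.
have : 0 <= (1/2 - x) * y by rewrite mulr_ge0 // subr_ge0.
by move: IH; set S := \sum_(_ < _) _; move: S => S; nra.
Qed.

Lemma pairs_in_le (N : nat) (T : {set 'I_N}) :
  (2 * (\sum_(i < N) \sum_(j < N | (i < j)%N) ((i \in T) && (j \in T))) <= #|T| ^ 2)%N.
Proof.
rewrite mul2n -addnn.
have -> : (#|T| ^ 2 = \sum_(i < N) \sum_(j < N) ((i \in T) && (j \in T)))%N.
  rewrite -mulnn -{1}sum1_card big_distrl /= big_mkcond /=; apply: eq_bigr => i _.
  case: (i \in T) => /=; last by rewrite big1.
  by rewrite mul1n -sum1_card big_mkcond; apply: eq_bigr => j _; case: (j \in T).
have {2}-> : (\sum_(i < N) \sum_(j < N | (i < j)%N) ((i \in T) && (j \in T)) =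
   \sum_(i < N) \sum_(j < N | (j < i)%N) ((i \in T) && (j \in T)))%N.
  rewrite (exchange_big_dep xpredT) //=; apply: eq_bigr => i _.
  by apply: eq_bigr => j _; rewrite andbC.
rewrite -big_split /=; apply: leq_sum => i _.
rewrite [leqRHS](bigID (fun j : 'I_N => (i < j)%N)) /= leq_add2l.
rewrite [leqLHS]big_mkcond [leqRHS]big_mkcond; apply: leq_sum => j _.
by case: (ltngtP j i).
Qed.

Lemma prod_pairs_in_le (N : nat) (T : {set 'I_N}) (b : R) (f : 'I_N -> 'I_N -> R) :
  0 <= b ->
  (forall i j, 0 <= f i j <= if (i \in T) && (j \in T) then expR b else 1) ->
  \prod_(i < N) \prod_(j < N | (i < j)%N) f i j <= expR (b * #|T|%:R ^+ 2 / 2).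
Proof.
move=> b0 hf.
apply: (@le_trans _ _ (\prod_(i < N) \prod_(j < N | (i < j)%N)
   expR (b * ((i \in T) && (j \in T))%:R))).
  apply: ler_prod => i _; rewrite prodr_ge0 /=; last by move=> j _; case/andP: (hf i j).
  apply: ler_prod => j _; move: (hf i j).
  by case: ifP; rewrite ?mulr1 ?mulr0 ?expR0.
under eq_bigr => i _ do rewrite -expR_sum.
rewrite -expR_sum ler_expR.
under eq_bigr => i _ do rewrite -mulr_sumr.
rewrite -mulr_sumr -mulrA ler_wpM2l //.
under eq_bigr => i _ do rewrite -natr_sum.
rewrite -natr_sum ler_pdivlMr // mulrC -natrX -natrM ler_nat.
exact: pairs_in_le.
Qed.

Lemma bin_sub_le (N n k : nat) : (k <= n)%N -> (n <= N)%N ->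
  'C(N - k, n - k)%:R <= 'C(N, n)%:R * (n%:R / N%:R) ^+ k :> R.
Proof.
elim: k => [|k IH] kn nN; first by rewrite !subn0 expr0 mulr1.
have kN : (k < N)%N by apply: leq_trans nN.
apply: (@le_trans _ _ ('C(N - k, n - k)%:R * (n%:R / N%:R))); last first.
  by rewrite exprSr [leRHS]mulrA ler_wpM2r ?IH ?(ltnW kn) // divr_ge0.
have := mul_bin_diag (N - k) (n - k.+1).
rewrite -subnS -subSn // subSS => /(congr1 (fun x => x%:R : R)); rewrite !natrM => E.
have Nk0 : 0 < (N - k)%:R :> R by rewrite ltr0n subn_gt0.
rewrite mulrA ler_pdivlMr ?ltr0n ?(leq_ltn_trans _ kN) //.
rewrite -(ler_pM2l Nk0) mulrA E.
rewrite -mulrA mulrCA [leRHS]mulrCA ler_wpM2l // -!natrM ler_nat.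
by rewrite !mulnBl [(N * n)%N]mulnC leq_sub2l // leq_mul.
Qed.

(** Union bound over the [k]-subsets [U] of [S] contained in [T]: there are ['C(n, k) <= n^k / k!]
    of them, and each lies in a proportion at most [(n / N)^k] of the sets of size [n]. *)
Lemma overlap_count (N n k : nat) (S : {set 'I_N}) : #|S| = n -> (n <= N)%N -> (k <= n)%N ->
  #|[set T : {set 'I_N} | (#|T| == n) && (#|S :&: T| == k)]|%:R <=
  (n%:R ^+ 2 / N%:R) ^+ k / k`!%:R * 'C(N, n)%:R :> R.
Proof.
move=> Sn nN kn.
apply: (@le_trans _ _ ('C(n, k) * 'C(N - k, n - k))%:R).
  rewrite ler_nat.
  have -> : 'C(n, k) = #|[set U : {set 'I_N} | U \subset S & #|U| == k]|.
    by rewrite cards_draws Sn.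
  (* Removing [U] maps the sets counted by [sup U] bijectively onto the subsets of size [n - k] of
     the complement of [U]. *)
  pose sup (U : {set 'I_N}) := [set T : {set 'I_N} | (U \subset T) && (#|T| == n)].
  have supE (U : {set 'I_N}) : #|U| = k -> #|sup U| = 'C(N - k, n - k).
    move=> Uk; have -> : (N - k)%N = #|~: U| by rewrite cardsCs finset.setCK card_ord Uk.
    rewrite -cards_draws -(card_in_imset (f := fun A => A :\: U)); last first.
      move=> A B; rewrite !inE => /andP[UA _] /andP[UB _] E.
      by rewrite -(finset.setID A U) -(finset.setID B U) (finset.setIidPr UA) (finset.setIidPr UB) E.
    apply/eq_card => B; apply/imsetP/idP.
      move=> [A]; rewrite !inE => /andP[UA /eqP An] ->.
      by rewrite cardsD (finset.setIidPr UA) An Uk eqxx andbT finset.setDE finset.subsetIr.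
    rewrite inE => /andP[BU /eqP Bc]; exists (U :|: B).
      rewrite inE finset.subsetUl /= cardsU Bc Uk.
      by rewrite (disjoint_setI0 (A := U)) ?cards0 ?subn0 ?subnKC // disjoint_sym finset.disjoints_subset.
    by rewrite finset.setDUl finset.setDv finset.set0U; apply/esym/finset.setDidPl; rewrite finset.disjoints_subset.
  pose P := [set U : {set 'I_N} | U \subset S & #|U| == k].
  apply: (@leq_trans (\sum_(U in P) #|sup U|)); last first.
    by rewrite (eq_bigr (fun=> 'C(N - k, n - k))) ?sum_nat_const // => U; rewrite inE => /andP[_ /eqP/supE].
  under [X in (_ <= X)%N]eq_bigr => U _ do rewrite -sum1_card big_mkcond /=.
  rewrite exchange_big /= -sum1_card big_mkcond /=; apply: leq_sum => T _.
  case: ifP => //; rewrite inE => /andP[Tn STk].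
  by rewrite (bigD1 (S :&: T)) /= ?inE ?finset.subsetIl ?STk // finset.subsetIr Tn.
rewrite natrM.
apply: le_trans (ler_wpM2l _ (bin_sub_le kn nN)) _ => //.
rewrite mulrCA mulrC ler_wpM2r // expr2 -mulrA.
have : 0 <= n%:R / N%:R :> R by rewrite divr_ge0.
move: (n%:R / N%:R) => y y0; rewrite exprMn mulrAC ler_wpM2r ?exprn_ge0 //.
rewrite ler_pdivlMr ?ltr0n ?fact_gt0 // -natrM bin_ffact -natrX ler_nat.
by rewrite ffact_prod -[X in (_ ^ X)%N]card_ord -prod_nat_const leq_prod // => i _; rewrite leq_subr.
Qed.

End Combinatorics.

(** * Truncated second moment *)

Section SecondMoment.
Variables (R : realType) (N : nat) (p0 p1 : R).
Hypotheses (p0_gt0 : 0 < p0) (p0_lt1 : p0 < 1) (p1_ge0 : 0 <= p1) (p1_le1 : p1 <= 1).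
Implicit Types (S T U : {set 'I_N}) (G : sgraph N).

Definition both S (i j : 'I_N) : bool := (i \in S) && (j \in S).

Lemma bothI S T i j : both (S :&: T) i j = both S i j && both T i j.
Proof. by rewrite /both !inE andbACA. Qed.

Lemma edges_in_pairs G T : edges_in G T =
  (\sum_(i < N) \sum_(j < N | (i < j)%N) (both T i j && adj G i j))%N.
Proof.
rewrite /edges_in big_mkcond; apply: eq_bigr => i _.
rewrite /both; case: (i \in T) => /=; last by rewrite big1.
rewrite big_mkcondl; apply: eq_bigr => j _; by case: (j \in T).
Qed.

Lemma expR_edges_in (a : R) G T : expR (a * (edges_in G T)%:R) =
  \prod_(i < N) \prod_(j < N | (i < j)%N) expR (a * (both T i j && adj G i j)%:R).
Proof.
rewrite edges_in_pairs natr_sum mulr_sumr expR_sum; apply: eq_bigr => i _.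
by rewrite natr_sum mulr_sumr expR_sum.
Qed.

Lemma planted_law_ge0 S G : 0 <= planted_law p0 p1 S G.
Proof.
apply: graph_law_ge0 => i j.
by case: ifP => _; rewrite ?p1_ge0 ?p1_le1 ?(ltW p0_gt0) ?(ltW p0_lt1).
Qed.

Lemma planted_law_sum S : \sum_G planted_law p0 p1 S G = 1.
Proof. exact: graph_law_sum. Qed.

Lemma null_law_ge0 G : 0 <= null_law p0 G.
Proof. by apply: graph_law_ge0 => i j; rewrite !ltW. Qed.

Definition likelihood S G : R := \prod_(i < N) \prod_(j < N | (i < j)%N)
  (if both S i j then bernoulli_pmf p1 (adj G i j) / bernoulli_pmf p0 (adj G i j) else 1).

Lemma bernoulli_pmf_neq0 b : bernoulli_pmf p0 b != 0.
Proof. by case: b; rewrite /= gt_eqF // subr_gt0. Qed.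

Lemma planted_lawE S G : planted_law p0 p1 S G = null_law p0 G * likelihood S G.
Proof.
rewrite -big_split; apply: eq_bigr => i _; rewrite -big_split; apply: eq_bigr => j _ /=.
rewrite -/(both S i j); case: (both S i j); last by rewrite mulr1.
by rewrite mulrCA mulfV ?mulr1 ?bernoulli_pmf_neq0.
Qed.

Lemma likelihood_ge0 S G : 0 <= likelihood S G.
Proof.
apply: prodr_ge0 => i _; apply: prodr_ge0 => j _; case: ifP => // _.
by rewrite divr_ge0 // bernoulli_pmf_ge0 // ?p1_ge0 ?(ltW p0_gt0) ?(ltW p0_lt1).
Qed.

(** Only the pairs inside [S :&: T] matter: on any other pair at most one likelihood factor is
    present, and it has mean 1 under the null law. The parameter [s] is the tilt; [s = 0] gives the
    plain second moment. *)
Lemma likelihood_product (s b : R) S T : 0 <= b ->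
  p1 ^+ 2 / p0 * expR (- s) + (1 - p1) ^+ 2 / (1 - p0) <= expR b ->
  Ex (null_law p0) (fun G => likelihood S G * likelihood T G *
     expR (- s * (edges_in G (S :&: T))%:R)) <= expR (b * #|S :&: T|%:R ^+ 2 / 2).
Proof.
move=> b0 hb.
pose lr U (i j : 'I_N) (a : bool) :=
  if both U i j then bernoulli_pmf p1 a / bernoulli_pmf p0 a else 1.
pose g i j a := lr S i j a * lr T i j a * expR (- s * (both (S :&: T) i j && a)%:R).
have -> : Ex (null_law p0) (fun G => likelihood S G * likelihood T G *
     expR (- s * (edges_in G (S :&: T))%:R)) = Ex (null_law p0)
     (fun G => \prod_(i < N) \prod_(j < N | (i < j)%N) g i j (adj G i j)).
  apply: eq_bigr => G _; congr (_ * _).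
  rewrite expR_edges_in -!big_split; apply: eq_bigr => i _ /=.
  by rewrite -!big_split.
rewrite Ex_prod; apply: prod_pairs_in_le => // i j.
have q0 : 0 < 1 - p0 by rewrite subr_gt0.
have q1 : 0 <= 1 - p1 by rewrite subr_ge0.
rewrite -/(both (S :&: T) i j) /g /lr bothI.
case: (both S i j) => /=; case: (both T i j) => /=;
  rewrite ?mulr1 ?mulr0 ?expR0 ?mulr1 ?mul1r.
- apply/andP; split.
    have P0 := ltW p0_gt0; have Q0 := ltW q0.
    by rewrite addr_ge0 // !mulr_ge0 ?invr_ge0 ?expR_ge0.
  apply: le_trans hb; rewrite le_eqVlt; apply/orP; left; apply/eqP.
  by field; rewrite !gt_eqF.
- rewrite [X in 0 <= X <= _](_ : _ = 1) ?lexx ?ler01 //.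
  by field; rewrite !gt_eqF.
- rewrite [X in 0 <= X <= _](_ : _ = 1) ?lexx ?ler01 //.
  by field; rewrite !gt_eqF.
- by rewrite addrC subrK lexx ler01.
Qed.

(** The admissible density depends on the size of the subset because case 4 uses two levels. By
    strictness the empty set never violates the constraint. *)
Definition overdense (c : nat -> R) S G : bool :=
  [exists T : {set 'I_N}, (T \subset S) && (c #|T| * #|T|%:R < (edges_in G T)%:R)].

Lemma overdensePn c S G T : ~~ overdense c S G -> T \subset S ->
  (edges_in G T)%:R <= c #|T| * #|T|%:R.
Proof. by move=> /existsPn/(_ T); rewrite negb_and => /orP[/negPf->|] //; rewrite -leNgt. Qed.

Definition truncated c S G : R := likelihood S G * (~~ overdense c S G)%:R.

Lemma truncated_ge0 c S G : 0 <= truncated c S G.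
Proof. by rewrite mulr_ge0 ?likelihood_ge0. Qed.

(** The maximum with 1 keeps the tilt [ln (density k)] nonnegative; there is no tilt as long as
    [D k <= 1]. *)
Let density k : R := Num.max 1 (p1 ^+ 2 / p0 * k%:R).
Let chi2 : R := (p1 - p0) ^+ 2 / (p0 * (1 - p0)).

(** The truncation is dropped here: [1 + chi2] is the second moment of the likelihood ratio of a
    single edge. *)
Lemma truncated_product_bulk c S T :
  Ex (null_law p0) (fun G => truncated c S G * truncated c T G) <=
  expR (chi2 * #|S :&: T|%:R ^+ 2 / 2).
Proof.
have q0 : 0 < 1 - p0 by rewrite subr_gt0.
have c0 : 0 <= chi2 by rewrite divr_ge0 ?sqr_ge0 // mulr_ge0 ?ltW.
apply: le_trans (@likelihood_product 0 chi2 S T c0 _); last first.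
  rewrite oppr0 expR0 (le_trans _ (expR_ge1Dx _)) // le_eqVlt; apply/orP; left.
  by apply/eqP; rewrite /chi2; field; rewrite !gt_eqF.
apply: Ex_le => [G|G]; first exact: null_law_ge0.
rewrite oppr0 mul0r expR0 mulr1 /truncated mulrACA ler_piMr ?mulr_ge0 ?likelihood_ge0 //.
by case: (overdense _ _ _); case: (overdense _ _ _); rewrite ?mulr0 ?mul0r ?mulr1.
Qed.

(* On the truncation event [W <= c k], hence [exp (s (c k - W)) >= 1] for
   [s = ln (density k)]; this tilt makes the quadratic term of order [k]. *)
Lemma truncated_product_outer c S T (k := #|S :&: T|) : (0 < k)%N -> p0 < p1 ->
  Ex (null_law p0) (fun G => truncated c S G * truncated c T G) <=
  (density k `^ c k * expR (1 / 2)) ^+ k.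
Proof.
move=> k0 p01; have q0 : 0 < 1 - p0 by rewrite subr_gt0.
have d1 : 1 <= density k by rewrite le_max lexx.
have d0 : 0 < density k by apply: lt_le_trans d1.
pose s := ln (density k).
have s0 : 0 <= s by rewrite ln_ge0.
pose b : R := k%:R^-1.
have kR : 0 < k%:R :> R by rewrite ltr0n.
have b0 : 0 <= b by rewrite invr_ge0.
have -> : (density k `^ c k * expR (1 / 2)) ^+ k =
   expR (s * (c k * k%:R)) * expR (b * k%:R ^+ 2 / 2).
  rewrite /powR gt_eqF // -expRD -expRM_natl -expRD; congr expR.
  by rewrite /b -/s; field; rewrite gt_eqF.
rewrite -ler_pdivrMl ?expR_gt0 // -expRN.
apply: le_trans (@likelihood_product s b S T b0 _).
  rewrite -ExZ; apply: Ex_le => [G|G]; first exact: null_law_ge0.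
  rewrite /truncated mulrACA.
  have [bS|gS] := boolP (overdense c S G).
    by rewrite mul0r !mulr0 mulr_ge0 ?expR_ge0 // mulr_ge0 ?likelihood_ge0.
  case: (overdense c T G); first by rewrite !mulr0 mulr_ge0 ?expR_ge0 // mulr_ge0 ?likelihood_ge0.
  rewrite !mulr1 mulrC ler_wpM2l ?mulr_ge0 ?likelihood_ge0 //.
  rewrite ler_expR mulNr lerN2 ler_wpM2l //.
  by apply: overdensePn gS _; rewrite finset.subsetIl.
(* The mean over one pair is at most [1 + b]: the absent edge contributes at most 1 since [p0 < p1],
   and the present edge at most [b = 1 / k] since [expR s >= D k]. *)
rewrite (le_trans _ (expR_ge1Dx _)) // addrC; apply: lerD.
  have : 0 <= (1 - p1) * p1 by rewrite mulr_ge0 // subr_ge0.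
  by rewrite ler_pdivrMr // mul1r; nra.
rewrite expRN lnK ?posrE // ler_pdivrMr // -ler_pdivrMl ?invr_gt0 // invrK mulrC.
by rewrite le_max lexx orbT.
Qed.

End SecondMoment.

(** * From the second moment to the risk *)

Section RiskBound.
Variables (R : realType) (N n : nat) (p0 p1 : R) (c : nat -> R) (A t : R).
Hypotheses (p0_gt0 : 0 < p0) (p0_lt1 : p0 < 1) (p01 : p0 < p1) (p1_le1 : p1 <= 1).
Hypotheses (n_leN : (n <= N)%N) (t_gt0 : 0 < t) (t_le : t <= 1 / 2).
Let rho : R := n%:R ^+ 2 / N%:R.
Let density k : R := Num.max 1 (p1 ^+ 2 / p0 * k%:R).
Hypothesis Hbad : forall S : {set 'I_N}, #|S| = n ->
  Pr (planted_law p0 p1 S) (overdense c S) <= t ^+ 2.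
Hypothesis Hbulk :
  expR ((p1 - p0) ^+ 2 / (p0 * (1 - p0)) * (A * rho) ^+ 2 / 2) <= 1 + t ^+ 2.
Hypothesis Houter : forall k, (0 < k <= n)%N -> A * rho < k%:R ->
  rho / k%:R * (density k `^ c k * expR (3 / 2)) <= t ^+ 2.

Let p1_ge0 : 0 <= p1. Proof. by rewrite ltW // (lt_trans p0_gt0). Qed.
Let Sn : pred {set 'I_N} := fun S => #|S| == n.
Let card_Sn : #|Sn|%:R = 'C(N, n)%:R :> R.
Proof. by rewrite -[N in RHS]card_ord -card_draws cardsE. Qed.
Let Sn_gt0 : 0 < #|Sn|%:R :> R.
Proof. by rewrite card_Sn ltr0n bin_gt0. Qed.

Let sum_Sn a : \sum_(S | Sn S) a = #|Sn|%:R * a :> R.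
Proof. by rewrite sumr_const mulr_natl. Qed.

(** Small overlaps cost [1 + t ^ 2]. A larger overlap size [k] contributes at most [(t ^ 2) ^ k],
    and the geometric series adds [2 t ^ 2]. The [3 / 2] in [Houter] is 1 from [1 / k! <= (e / k)^k]
    plus [1 / 2] from the tilted second moment. *)
Lemma second_moment_row (S : {set 'I_N}) : #|S| = n ->
  \sum_(T | Sn T) Ex (null_law p0) (fun G => truncated p0 p1 c S G * truncated p0 p1 c T G)
  <= #|Sn|%:R * (1 + 3 * t ^+ 2).
Proof.
move=> cS.
pose M k := (density k `^ c k * expR (1 / 2)) ^+ k.
have M0 k : 0 <= M k by rewrite exprn_ge0 // mulr_ge0 ?powR_ge0 ?expR_ge0.
have t2 : 0 <= t ^+ 2 <= 1 / 2.
  rewrite sqr_ge0 /= expr2; have := t_gt0; have := t_le; nra.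
pose out (k : 'I_n) := A * rho < k.+1%:R.
apply: (@le_trans _ _ (\sum_(T | Sn T) ((1 + t ^+ 2) +
   \sum_(k < n | out k) (#|S :&: T| == k.+1)%:R * M k.+1))).
  apply: ler_sum => T _.
  have S0 : 0 <= \sum_(k < n | out k) (#|S :&: T| == k.+1)%:R * M k.+1.
    by apply: sumr_ge0 => k _; rewrite mulr_ge0.
  have STn : (#|S :&: T| <= n)%N by rewrite -cS subset_leq_card // finset.subsetIl.
  have [le|gt] := leP (#|S :&: T|%:R) (A * rho).
    apply: le_trans (truncated_product_bulk _ _ _ _ _ _ _) _ => //.
    apply: le_trans (_ : 1 + t ^+ 2 <= _); last by rewrite lerDl.
    apply: le_trans Hbulk; rewrite ler_expR ler_pM2r ?invr_gt0 // ler_wpM2l //.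
      by rewrite divr_ge0 ?sqr_ge0 // mulr_ge0 ?subr_ge0 // ltW.
    by rewrite lerXn2r ?nnegrE // (le_trans _ le).
  (* When [A * rho] is negative, an empty overlap ends up in this branch; the untruncated bound is
     then exactly 1. *)
  have [k0|k0] := posnP #|S :&: T|.
    apply: le_trans (truncated_product_bulk _ _ _ _ _ _ _) _ => //.
    rewrite k0 expr0n /= mulr0 mul0r expR0 -addrA lerDl addr_ge0 //; first by case/andP: t2.
    by apply: sumr_ge0 => k _; rewrite mul0r.
  apply: (@le_trans _ _ (M #|S :&: T|)); first exact: truncated_product_outer.
  have k1 : (#|S :&: T|.-1 < n)%N by rewrite prednK.
  rewrite (bigD1 (Ordinal k1)) /out /= prednK // eqxx (_ : (true : nat)%:R = 1 :> R) // mul1r.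
  rewrite addrCA lerDl addr_ge0 //; first by rewrite addr_ge0 //; case/andP: t2.
  by apply: sumr_ge0 => k _; rewrite mulr_ge0.
rewrite big_split /= sum_Sn (_ : 1 + 3 * t ^+ 2 = (1 + t ^+ 2) + 2 * t ^+ 2); last by ring.
rewrite [leRHS]mulrDr lerD2l exchange_big /=.
apply: (@le_trans _ _ (\sum_(k < n | out k) #|Sn|%:R * (t ^+ 2) ^+ k.+1)); last first.
  rewrite -mulr_sumr ler_pM2l //; apply: le_trans (geometric_tail_le n t2).
  rewrite [leLHS]big_mkcond ler_sum // => k _; case: ifP => // _.
  by rewrite exprn_ge0 // sqr_ge0.
apply: ler_sum => k ok; rewrite -mulr_suml.
have -> : \sum_(T | Sn T) (#|S :&: T| == k.+1)%:R =
   #|[set T : {set 'I_N} | (#|T| == n) && (#|S :&: T| == k.+1)]|%:R :> R.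
  rewrite -natr_sum -sum1_card; congr _%:R.
  rewrite big_mkcond [RHS]big_mkcond; apply: eq_bigr => T _; rewrite inE /Sn.
  by case: eqP => //=; case: eqP.
apply: le_trans (ler_wpM2r (M0 _) (overlap_count R cS n_leN (ltn_ord k))) _.
rewrite -/rho card_Sn mulrAC mulrC ler_wpM2l //.
have k0 : 0 < k.+1%:R :> R by [].
have rho0 : 0 <= rho by rewrite divr_ge0 ?exprn_ge0.
apply: (@le_trans _ _ ((rho / k.+1%:R * (density k.+1 `^ c k.+1 * expR (3 / 2))) ^+ k.+1)); last first.
  rewrite lerXn2r ?nnegrE ?Houter ?ltn_ord //; last by case/andP: t2.
  by rewrite !mulr_ge0 ?powR_ge0 ?expR_ge0 ?invr_ge0.
have -> : expR (3 / 2) = expR 1 * expR (1 / 2) :> R by rewrite -expRD; congr expR; field.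
rewrite (_ : rho / k.+1%:R * (density k.+1 `^ c k.+1 * (expR 1 * expR (1 / 2))) =
  (rho / k.+1%:R * expR 1) * (density k.+1 `^ c k.+1 * expR (1 / 2))); last by ring.
rewrite [leRHS]exprMn ler_wpM2r //; move: rho rho0 => r r0.
rewrite !exprMn -mulrA ler_wpM2l ?exprn_ge0 //.
rewrite -expRM_natl mulr1 exprVn -[leLHS]mul1r ler_pdivrMr ?ltr0n ?fact_gt0 //.
rewrite -mulrA ler_pdivlMl ?exprn_gt0 // mulr1 mulrC.
exact: expn_le_fact_expR.
Qed.

Lemma risk_ge (phi : test N) : 1 - 3 * t <= risk n p0 p1 phi.
Proof.
pose L G := #|Sn|%:R^-1 * \sum_(S | Sn S) truncated p0 p1 c S G.
pose mu0 := @null_law R N p0.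
have mu0_ge0 G : 0 <= mu0 G by exact: null_law_ge0.
have mu0_sum : \sum_G mu0 G = 1 by exact: graph_law_sum.
have L0 G : 0 <= L G.
  by rewrite mulr_ge0 ?invr_ge0 ?ler0n // sumr_ge0 // => S _; apply: truncated_ge0.
have EL S (f : sgraph N -> R) :
    Ex mu0 (fun G => truncated p0 p1 c S G * f G) =
    Ex (planted_law p0 p1 S) (fun G => (~~ overdense c S G)%:R * f G).
  by apply: eq_bigr => G _; rewrite planted_lawE // !mulrA.
have avg (f : sgraph N -> R) : Ex mu0 (fun G => L G * f G) =
    #|Sn|%:R^-1 * \sum_(S | Sn S) Ex (planted_law p0 p1 S) (fun G => (~~ overdense c S G)%:R * f G).
  under [in RHS]eq_bigr => S _ do rewrite -EL.
  rewrite -Ex_sum -ExZ; apply: eq_bigr => G _; congr (_ * _).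
  by rewrite /L -mulrA mulr_suml.
have E1 : 1 - t ^+ 2 <= Ex mu0 L.
  have -> : Ex mu0 L = Ex mu0 (fun G => L G * 1).
    by apply: eq_bigr => G _; rewrite mulr1.
  rewrite avg ler_pdivlMl // -sum_Sn; apply: ler_sum => S /eqP cS.
  under [X in _ <= X]eq_bigr => G _ do rewrite mulr1.
  have -> : \sum_G planted_law p0 p1 S G * (~~ overdense c S G)%:R =
     Pr (planted_law p0 p1 S) (fun G => ~~ overdense c S G) by rewrite PrE.
  rewrite Pr_compl ?planted_law_sum //.
  by rewrite lerD2l lerN2 Hbad.
have E2 : Ex mu0 (fun G => L G ^+ 2) <= 1 + 3 * t ^+ 2.
  have -> : Ex mu0 (fun G => L G ^+ 2) = #|Sn|%:R^-1 * \sum_(S | Sn S) (#|Sn|%:R^-1 *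
     \sum_(T | Sn T) Ex (null_law p0) (fun G => truncated p0 p1 c S G * truncated p0 p1 c T G)).
    under [in RHS]eq_bigr => S _ do rewrite -Ex_sum -ExZ.
    rewrite -Ex_sum -ExZ; apply: eq_bigr => G _; congr (_ * _).
    rewrite expr2 {1}/L -mulrA mulr_suml; congr (_ * _); apply: eq_bigr => S _.
    by rewrite /L mulrCA mulr_sumr.
  rewrite ler_pdivrMl // -sum_Sn; apply: ler_sum => S /eqP cS.
  rewrite ler_pdivrMl //; exact: second_moment_row.
(* [min 1 x >= 1 - t/2 - (1 - x)^2 / (2 t)] avoids the square root of Cauchy-Schwarz. *)
apply: (@le_trans _ _ (Ex mu0 (fun G => (phi G)%:R + L G * (~~ phi G)%:R))); last first.
  (* The maximum over [S] dominates the average, and truncation only lowers the likelihood ratio. *)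
  rewrite ExD -PrE; apply: lerD => //; rewrite avg.
  set B := \big[_/_]_(_ | _) _.
  rewrite ler_pdivrMl // -sum_Sn; apply: ler_sum => S cS.
  apply: (@le_trans _ _ (Pr (planted_law p0 p1 S) (fun G => ~~ phi G))).
    rewrite PrE; apply: Ex_le => G; first exact: planted_law_ge0.
    by case: (overdense _ _ _); rewrite ?mul0r ?mul1r.
  exact: (le_bigmax_cond _ (fun S => Pr (planted_law p0 p1 S) (fun G => ~~ phi G)) cS).
(* With [E L >= 1 - t ^ 2] and [E L ^ 2 <= 1 + 3 t ^ 2], the mean of this quadratic is at least
   [1 - 3 t]; this fixes the constant 3. *)
apply: (@le_trans _ _ (Ex mu0 (fun G => (1 - t / 2 - (2 * t)^-1) +
    (t^-1 * L G + - (2 * t)^-1 * L G ^+ 2)))).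
  rewrite ExD Ex_cst // ExD (ExZ mu0 t^-1 L) (ExZ mu0 _ (fun G => L G ^+ 2)).
  have := E1; have := E2; set x := Ex _ _; set y := Ex _ _ => h1 h2.
  have : t^-1 * (1 - t ^+ 2) <= t^-1 * y by rewrite ler_pM2l ?invr_gt0.
  have : (2 * t)^-1 * x <= (2 * t)^-1 * (1 + 3 * t ^+ 2).
    by rewrite ler_pM2l ?invr_gt0 // mulr_gt0.
  have -> : t^-1 * (1 - t ^+ 2) = t^-1 - t by field; rewrite gt_eqF.
  have -> : (2 * t)^-1 * (1 + 3 * t ^+ 2) = t^-1 / 2 + 3 / 2 * t by field; rewrite gt_eqF.
  have -> : (2 * t)^-1 = t^-1 / 2 by field; rewrite gt_eqF.
  move: (t^-1) => u; lra.
apply: Ex_le => // G; have := L0 G; move: (L G) => x x0.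
have -> : 1 - t / 2 - (2 * t)^-1 + (t^-1 * x + - (2 * t)^-1 * x ^+ 2) =
   1 - (t ^+ 2 + (1 - x) ^+ 2) / (2 * t) by field; rewrite gt_eqF.
have H1 : 1 - x <= (t ^+ 2 + (1 - x) ^+ 2) / (2 * t).
  by rewrite ler_pdivlMr ?mulr_gt0 //; have := sqr_ge0 (t - (1 - x)); nra.
have H2 : 0 <= (t ^+ 2 + (1 - x) ^+ 2) / (2 * t).
  by rewrite divr_ge0 ?addr_ge0 ?sqr_ge0 // mulr_ge0 // ltW.
by case: (phi G) => /=; lra.
Qed.

Lemma minimax_risk_ge : 1 - 3 * t <= minimax_risk N n p0 p1.
Proof.
apply: lb_le_inf; first by exists (@risk R N n p0 p1 (fun=> true)), (fun=> true).
by move=> _ [phi _ <-]; apply: risk_ge.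
Qed.

(** The test that always rejects has risk 1. The lower bound [risk_ge] also makes the infimum
    meaningful. *)
Lemma minimax_risk_le1 : minimax_risk N n p0 p1 <= 1.
Proof.
apply: ge_inf; first by exists (1 - 3 * t) => _ [phi _ <-]; apply: risk_ge.
exists (fun=> true) => //; rewrite /risk.
rewrite (_ : Pr _ _ = 1); last exact: graph_law_sum.
rewrite (_ : \big[_/_]_(_ | _) _ = 0) ?addr0 //.
elim/big_ind: _ => [//|x y -> ->|S _]; first exact: maxxx.
by rewrite /Pr big_pred0.
Qed.

End RiskBound.

(** * Paths with two chords *)

Section Traceable.
Variables (N : nat) (G : sgraph N).
Implicit Types (S T X : {set 'I_N}) (u v w : 'I_N) (x p : seq 'I_N).
Local Notation e := (adj G : rel 'I_N).

Definition degree T v : nat := #|[set u in T | e v u]|.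

Lemma degreeE T v : degree T v = (\sum_(u in T) e v u)%N.
Proof.
rewrite /degree -sum1_card big_mkcond [RHS]big_mkcond; apply: eq_bigr => u _.
by rewrite inE; case: (u \in T) => //=; case: (e v u).
Qed.

Lemma sum_degree T : (\sum_(v in T) degree T v = 2 * edges_in G T)%N.
Proof.
rewrite mul2n -addnn /edges_in.
have {2}-> : (\sum_(i in T) \sum_(j in T | (i < j)%N) e i j =
   \sum_(i in T) \sum_(j in T | (j < i)%N) e i j)%N.
  rewrite (exchange_big_dep (fun j => j \in T)) /=; last by move=> i j _ /andP[].
  apply: eq_bigr => j jT; rewrite big_mkcond [RHS]big_mkcond; apply: eq_bigr => i _.
  by rewrite jT andTb adjC.
rewrite -big_split /=; apply: eq_bigr => i iT; rewrite degreeE.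
rewrite (bigID (fun j : 'I_N => (i < j)%N)) /=; congr (_ + _)%N.
rewrite big_mkcond [RHS]big_mkcond; apply: eq_bigr => j _.
case: (j \in T) => //=; case: (ltngtP i j) => //= /val_inj ->; by rewrite adjii.
Qed.

(** Doubling turns the sums over [i < j] into degree sums, which are symmetric in the vertices, so
    that removing [v] is direct. *)
Lemma edges_in_D1 T v : v \in T ->
  edges_in G T = (edges_in G (T :\ v) + degree T v)%N.
Proof.
move=> vT; apply/eqP; rewrite -(eqn_pmul2l (m := 2)) // mulnDr -!sum_degree; apply/eqP.
rewrite (big_setD1 v) //=.
have -> : (\sum_(u in T :\ v) degree T u =
   \sum_(u in T :\ v) (degree (T :\ v) u + e v u))%N.
  apply: eq_bigr => u _; rewrite !degreeE (big_setD1 v) //= addnC; congr (_ + _)%N.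
  by rewrite adjC.
rewrite big_split /= mul2n -addnn {3}degreeE (big_setD1 v vT) /= adjii add0n.
by rewrite addnCA addnA.
Qed.

Lemma size_le_degree T v p : uniq p -> {subset p <= T} -> {in p, forall u, e v u} ->
  (size p <= degree T v)%N.
Proof.
move=> Up pT pe; rewrite -(card_uniqP Up); apply: subset_leq_card.
by apply/fintype.subsetP => u up; rewrite inE pT ?pe.
Qed.

Lemma edges_in_mono X T : X \subset T -> (edges_in G X <= edges_in G T)%N.
Proof.
move=> /fintype.subsetP XT; rewrite /edges_in big_mkcond [leqRHS]big_mkcond.
apply: leq_sum => i _; case: (boolP (i \in X)) => // /XT ->.
rewrite big_mkcond [leqRHS]big_mkcond; apply: leq_sum => j _.
by case: (boolP (j \in X)) => //= /XT ->.
Qed.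

Lemma longest_path T v : v \in T -> exists x,
  [/\ uniq x, {subset x <= T}, sorted e x, v \in x &
   forall y, uniq y -> {subset y <= T} -> sorted e y -> v \in y -> (size y <= size x)%N].
Proof.
move=> vT.
pose ok x := [&& uniq x, all (mem T) x, sorted e x & v \in x].
pose Q k := [exists t : k.-tuple 'I_N, ok t].
have Q1 : exists k, Q k.
  by exists 1%N; apply/existsP; exists [tuple v]; rewrite /ok /= mem_seq1 eqxx vT.
have Qb k : Q k -> (k <= N)%N.
  move=> /existsP[t /and4P[Ut _ _ _]]; rewrite -(size_tuple t) -(card_uniqP Ut).
  by rewrite -[X in (_ <= X)%N]card_ord max_card.
case: (ex_maxnP Q1 Qb) => k /existsP[t /and4P[Ut /allP Tt st vt]] kmax.
exists t; split => // y Uy yT sy vy; rewrite size_tuple; apply: kmax.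
by apply/existsP; exists (in_tuple y); rewrite /ok /= Uy sy vy !andbT /=; apply/allP.
Qed.

Lemma path_inner_neighbours x p q u v w : uniq x -> sorted e x ->
  x = rcons p u ++ v :: w :: q -> [/\ e v u, e v w, u \in x, w \in x & u != w].
Proof.
move=> Ux sx E; move: Ux sx; rewrite E.
rewrite cat_rcons; case: p {E} => [|a p] /=.
  move=> /and3P[]; rewrite !inE !negb_or => /andP[_ /andP[uw _]] _ _.
  by move=> /and3P[euv evw _]; rewrite adjC euv evw !eqxx ?orbT.
rewrite mem_cat cat_uniq !cat_path /= !inE !negb_or => /and4P[_ _ _ /and3P[]].
move=> /and3P[_ uw _] _ _ /and5P[_ _ euv evw _].
by rewrite adjC euv evw uw !mem_cat !inE !eqxx !orbT.
Qed.

(* A longest path among those through a vertex [v] of degree at least 3. If it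
   carried no two chords, its vertex set would induce a cycle, and this cycle,
   cut at [v], could be prolonged by a neighbour of [v] outside of it. *)
Lemma exists_traceable T : (#|T| < edges_in G T)%N -> exists x,
  [/\ uniq x, {subset x <= T}, sorted e x, x != [::] &
      (size x < edges_in G [set u in x])%N].
Proof.
have [m] := ubnP #|T|; elim: m T => // m IH T leTm WT.
(* Deleting a vertex of degree at most 1 keeps more edges than vertices, so all degrees may be
   assumed at least 2; the excess of edges then forces a vertex of degree at least 3. *)
have [/exists_inP[v vT dv]|/exists_inPn d2] :=
    boolP [exists v in T, (degree T v <= 1)%N].
  have cT := cardsD1 v T; rewrite vT add1n in cT.
  case: (IH (T :\ v)) => [||x [Ux xT sx x0 Wx]].
  - by rewrite -ltnS -cT.
  - by rewrite -(ltn_add2r (degree T v)) -edges_in_D1 // (leq_ltn_trans _ WT) // cT -addn1 leq_add2l.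
  exists x; split => // u /xT; by rewrite !inE => /andP[].
have {}d2 v : v \in T -> (2 <= degree T v)%N by move=> /d2; rewrite -ltnNge.
have [v vT dv] : exists2 v, v \in T & (3 <= degree T v)%N.
  apply/exists_inP; apply: contraT => /exists_inPn d3.
  have : (\sum_(v in T) degree T v <= \sum_(v in T) 2)%N.
    by apply: leq_sum => v /d3; rewrite -ltnNge ltnS.
  by rewrite sum_degree sum_nat_const mulnC leq_pmul2r // leqNgt WT.
have [x [Ux xT sx vx xmax]] := longest_path vT.
exists x; split => //; first by apply/eqP => x0; rewrite x0 in vx.
rewrite ltnNge; apply/negP => WX.
set X := [set u in x] in WX.
have cX : #|X| = size x by rewrite cardsE (card_uniqP Ux).
have inX u : (u \in X) = (u \in x) by rewrite inE.
have inside u : (forall w, w \in T -> e u w -> w \in x) -> (degree T u <= degree X u)%N.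
  move=> H; apply: subset_leq_card; apply/fintype.subsetP => w; rewrite !inE.
  by move=> /andP[wT uw]; rewrite uw H.
(* By maximality an end of the path has all its neighbours in [T] on the path, so it keeps its full
   degree inside [X]. *)
have head_in a p : x = a :: p -> forall w, w \in T -> e a w -> w \in x.
  move=> E w wT aw; apply/negPn/negP => wx.
  suff : (size (w :: x) <= size x)%N by rewrite ltnn.
  apply: xmax; rewrite /= ?wx ?in_cons ?vx ?orbT //.
    by move=> y; rewrite in_cons => /orP[/eqP->|/xT].
  by move: sx; rewrite E /= adjC aw => ->.
have last_in p a : x = rcons p a -> forall w, w \in T -> e a w -> w \in x.
  move=> E w wT aw; apply/negPn/negP => wx.
  suff : (size (rcons x w) <= size x)%N by rewrite size_rcons ltnn.
  apply: xmax; rewrite ?rcons_uniq ?wx ?mem_rcons ?in_cons ?vx ?orbT //.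
    by move=> y; rewrite mem_rcons in_cons => /orP[/eqP->|/xT].
  move: sx; rewrite E; case: (p) => [|b q] /=; first by rewrite aw.
  by move=> qa; rewrite rcons_path qa last_rcons aw.
have dX u : u \in x -> (2 <= degree X u)%N.
  move=> ux; have dTu := d2 _ (xT _ ux).
  case/splitPr E : {-1}x / (ux) => [p q].
  case: p E => [|a p] E; first by apply: leq_trans dTu (inside _ (head_in _ _ E)).
  case: q E => [|b q] E.
    by apply: leq_trans dTu (inside _ (last_in (a :: p) u _)); rewrite E cats1.
  rewrite lastI in E.
  have [ua ub ax bx ab] := path_inner_neighbours Ux sx E.
  apply: (@size_le_degree X u [:: last a p; b]); rewrite /= ?mem_seq1 ?ab //.
    by move=> y; rewrite !inE => /orP[]/eqP->.
  by move=> y; rewrite !inE => /orP[]/eqP->.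
(* All degrees in [X] are at least 2, while [WX] bounds their sum by [2 * #|X|]. *)
have dX2 u : u \in x -> degree X u = 2%N.
  move=> ux; apply/eqP; rewrite eqn_leq dX // andbT leqNgt; apply/negP => d3.
  have : (\sum_(w in X) 2 < \sum_(w in X) degree X w)%N.
    rewrite (bigD1 u) ?inX //= [X in (_ < X)%N](bigD1 u) ?inX //= -addSn leq_add //.
    by apply: leq_sum => w /andP[]; rewrite inX => /dX.
  by rewrite sum_degree sum_nat_const mulnC ltn_pmul2l // cX ltnNge WX.
(* The head [a] has a neighbour [b] other than its successor. If [b] were not the last vertex, [a]
   and the two path neighbours of [b] would give [b] degree 3. *)
have cyc : path.cycle e x.
  case defx: x => [//|a p]; have sp := sx; have Up := Ux; rewrite defx in sp Up.
  have memx u : (u \in X) = (u \in a :: p) by rewrite inX defx.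
  rewrite /= rcons_path; move: (sp) => /= ->; rewrite andTb.
  have [b bx [ab bh]] : exists2 b, b \in a :: p & e a b /\ b != head a p.
    have : (1 < degree X a)%N by rewrite dX2 // defx mem_head.
    rewrite /degree (cardsD1 (head a p)) => d1.
    have : (0 < #|[set u in X | e a u] :\ head a p|)%N by rewrite lt0n; apply: contraTneq d1 => ->; rewrite addn0 -leqNgt leq_b1.
    by case/card_gt0P => b; rewrite in_setD1 finset.in_set memx => /and3P[bh bx ab]; exists b.
  have ba : b != a by apply: contraTneq ab => ->; rewrite adjii.
  have bp : b \in p by move: bx; rewrite inE (negbTE ba).
  case/splitPr E : {-1}p / (bp) => [q r].
  case: q E => [|c q] E; first by rewrite E /= eqxx in bh.
  case: r E => [|d r] E; first by rewrite E last_cat /= adjC.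
  have E' : a :: p = rcons (a :: belast c q) (last c q) ++ b :: d :: r.
    by rewrite rcons_cons -lastI E.
  have [bc bd cx dx cd] := path_inner_neighbours Up sp E'.
  have : (size [:: a; last c q; d] <= degree X b)%N.
    apply: size_le_degree.
    - move: Up; rewrite E /= !inE !negb_or mem_cat !inE !negb_or.
      move=> /andP[/andP[ac /andP[aq /andP[_ /andP[ad _]]]] _]; rewrite cd ad !andbT.
      by apply: contraTneq (mem_last c q) => <-; rewrite inE negb_or ac aq.
    - by move=> y; rewrite memx !inE => /or3P[]/eqP->; rewrite ?eqxx // -in_cons.
    - by move=> y; rewrite !inE => /or3P[]/eqP-> //; rewrite adjC.
  by rewrite dX2 // defx.
have [w wT /andP[vw wx]] : exists2 w, w \in T & e v w && (w \notin x).
  apply/exists_inP; apply: contraT => /exists_inPn H.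
  have : (degree T v <= degree X v)%N.
    by apply: inside => w /H; rewrite negb_and negbK => /orP[/negbTE->|].
  by rewrite dX2 // leqNgt dv.
(* Cutting the cycle at [v] and putting the outer neighbour [w] in front gives a path through [v]
   longer than [x]. *)
case: (rot_to vx) => i q E.
have : (size (w :: v :: q) <= size x)%N.
  apply: xmax.
  - by rewrite cons_uniq -E mem_rot rot_uniq wx.
  - by move=> y; rewrite in_cons -E mem_rot => /orP[/eqP->|/xT].
  - rewrite /= adjC vw /=; move: cyc; rewrite -(rot_cycle i) E /= rcons_path.
    by case/andP.
  - by rewrite !inE eqxx orbT.
by rewrite /= -[(size q).+1]/(size (v :: q)) -E size_rot ltnn.
Qed.

End Traceable.

(** * First moments under the planted law *)

Section FirstMoments.
Variables (R : realType) (N : nat) (p0 p1 : R) (S : {set 'I_N}).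
Hypotheses (p0_ge0 : 0 <= p0) (p01 : p0 < p1) (p1_le1 : p1 <= 1).
Implicit Types (T X : {set 'I_N}) (G : sgraph N) (x : seq 'I_N).

Let p1_gt0 : 0 < p1. Proof. exact: le_lt_trans p01. Qed.
Let law := @planted_law R N p0 p1 S.

Let law_ge0 G : 0 <= law G.
Proof.
apply: graph_law_ge0 => i j.
by case: ifP => _; rewrite ?p0_ge0 ?p1_le1 ?(ltW p1_gt0) // (le_trans (ltW p01)).
Qed.

Let law_sum : \sum_G law G = 1. Proof. exact: graph_law_sum. Qed.

Let planted_inside T i j : T \subset S -> both T i j ->
  (if (i \in S) && (j \in S) then p1 else p0) = p1.
Proof. by move=> /fintype.subsetP TS /andP[/TS-> /TS->]. Qed.

(** Chernoff bound with [expR s = 1 / (k p1)]: each pair then has exponential moment at most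
    [1 + 1 / k], and the at most [k ^ 2 / 2] pairs together cost [expR (k / 2)]. If [k p1 > 1] the
    right-hand side is at least 1. *)
Lemma dense_subset_prob T (c : R) : T \subset S -> 0 <= c -> (0 < #|T|)%N ->
  Pr law (fun G => c * #|T|%:R < (edges_in G T)%:R) <=
  (expR (1 / 2) * (#|T|%:R * p1) `^ c) ^+ #|T|.
Proof.
move=> TS c0 k0; set k := #|T|.
have kR : 0 < k%:R :> R by rewrite ltr0n.
have kp : 0 < k%:R * p1 by rewrite mulr_gt0.
have [h1|h1] := leP (k%:R * p1) 1; last first.
  apply: le_trans (Pr_le1 law_ge0 law_sum _) _.
  rewrite exprn_ege1 // -[leLHS]mulr1 ler_pM //; first by rewrite -[leLHS]expR0 ler_expR.
  by rewrite -[leLHS](powRr0 (k%:R * p1)) ler_powR // ltW.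
pose s := - ln (k%:R * p1).
have s0 : 0 <= s by rewrite oppr_ge0 ln_le0.
have es : expR s = (k%:R * p1)^-1 by rewrite expRN lnK.
apply: (@le_trans _ _ (Ex law (fun G => expR (- s * (c * k%:R)) * expR (s * (edges_in G T)%:R)))).
  apply: Pr_le_Ex => [//|G|G W]; first by rewrite mulr_ge0 ?expR_ge0.
  by rewrite -expRD -[leLHS]expR0 ler_expR mulNr addrC -mulrBr mulr_ge0 // subr_ge0 ltW.
have -> : (expR (1 / 2) * (k%:R * p1) `^ c) ^+ k = expR (- s * (c * k%:R)) * expR (k%:R / 2).
  rewrite /powR gt_eqF // -expRD -expRM_natl -expRD; congr expR; rewrite opprK; ring.
rewrite ExZ ler_pM2l ?expR_gt0 //.
pose g i j (a : bool) := expR (s * (both T i j && a)%:R).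
have -> : Ex law (fun G => expR (s * (edges_in G T)%:R)) = Ex law (fun G =>
   \prod_(i < N) \prod_(j < N | (i < j)%N) g i j (adj G i j)).
  by apply: eq_bigr => G _; rewrite expR_edges_in.
rewrite (Ex_prod _ g) /g.
have -> : k%:R / 2 = k%:R^-1 * k%:R ^+ 2 / 2 :> R by field; rewrite gt_eqF.
apply: prod_pairs_in_le => [|i j]; first by rewrite invr_ge0.
rewrite -/(both T i j); case: (boolP (both T i j)) => [bT|_]; last first.
  by rewrite mulr0 expR0 !mulr1 addrC subrK ler01 lexx.
rewrite (planted_inside TS bT) mulr1 mulr0 expR0 mulr1 es.
apply/andP; split; first by rewrite addr_ge0 ?mulr_ge0 ?invr_ge0 ?subr_ge0 // ltW.
apply: le_trans (expR_ge1Dx _); rewrite addrC invfM mulrCA mulfV ?gt_eqF // mulr1.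
by rewrite lerD2r gerBl ltW.
Qed.

Lemma bin_le_expR (n k : nat) : (0 < k)%N ->
  'C(n, k)%:R <= (expR 1 * n%:R / k%:R) ^+ k :> R.
Proof.
move=> k0; have kR : 0 < k%:R ^+ k :> R by rewrite exprn_gt0 // ltr0n.
have fR : 0 < k`!%:R :> R by rewrite ltr0n fact_gt0.
rewrite expr_div_n ler_pdivlMr // -(ler_pM2l fR) mulrA -natrM mulnC bin_ffact.
apply: (@le_trans _ _ (n%:R ^+ k * (k`!%:R * expR k%:R))).
  apply: ler_pM; rewrite ?exprn_ge0 //; last exact: expn_le_fact_expR.
  by rewrite -natrX ler_nat ffact_prod -[X in (_ ^ X)%N]card_ord -prod_nat_const leq_prod // => i _; rewrite leq_subr.
by rewrite exprMn -expRM_natl mulr1 le_eqVlt; apply/orP; left; apply/eqP; ring.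
Qed.

(** Union bound over the subsets of size [k]; the binomial coefficient raises the constant from
    [e^(1/2)] to [e^(3/2)]. *)
Lemma dense_size_prob (c : R) (k : nat) : 0 <= c -> (0 < k)%N ->
  Pr law (fun G => [exists T : {set 'I_N},
     [&& T \subset S, #|T| == k & c * k%:R < (edges_in G T)%:R]]) <=
  (expR (3 / 2) * (#|S|%:R / k%:R) * (k%:R * p1) `^ c) ^+ k.
Proof.
move=> c0 k0.
pose P := [set T : {set 'I_N} | T \subset S & #|T| == k].
apply: le_trans (Pr_exists law_ge0 (P := fun T => T \in P) (B := fun T G => c * k%:R < (edges_in G T)%:R) _) _.
  by move=> G /existsP[T /and3P[TS Tk W]]; exists T => //; rewrite /P inE TS.
apply: (@le_trans _ _ (\sum_(T in P) (expR (1 / 2) * (k%:R * p1) `^ c) ^+ k)).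
  apply: ler_sum => T; rewrite inE => /andP[TS /eqP Tk].
  by move: k0; rewrite -Tk => k0; apply: dense_subset_prob.
rewrite sumr_const cards_draws -[_ *+ _]mulr_natl.
apply: le_trans (ler_wpM2r _ (bin_le_expR _ k0)) _.
  by rewrite exprn_ge0 // mulr_ge0 ?expR_ge0 ?powR_ge0.
rewrite -exprMn le_eqVlt; apply/orP; left; apply/eqP; congr (_ ^+ _).
have -> : expR (3 / 2) = expR 1 * expR (1 / 2) :> R by rewrite -expRD; congr expR; field.
ring.
Qed.

(** [P] selects the sizes left to the union bound, whose bases at most [y] sum to [2 y]. In case 1
    these are all sizes, in case 4 those below [n / u_N]; the other sizes remain as a probability to
    be bounded by concentration. *)
Lemma overdense_prob_split (P : pred nat) (c : nat -> R) (y : R) : (forall k, 0 <= c k) ->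
  0 <= y <= 1 / 2 ->
  (forall k, (0 < k <= #|S|)%N -> P k ->
     expR (3 / 2) * (#|S|%:R / k%:R) * (k%:R * p1) `^ c k <= y) ->
  Pr law (overdense c S) <= 2 * y + Pr law (fun G => [exists T : {set 'I_N},
     [&& T \subset S, ~~ P #|T| & c #|T| * #|T|%:R < (edges_in G T)%:R]]).
Proof.
move=> c0 y01 hy.
pose A k G := [exists T : {set 'I_N},
  [&& T \subset S, #|T| == k & c k * k%:R < (edges_in G T)%:R]].
pose B G := [exists k : 'I_#|S|, P k.+1 && A k.+1 G].
apply: le_trans (Pr_or law_ge0 (B := B) (C := fun G => [exists T : {set 'I_N},
     [&& T \subset S, ~~ P #|T| & c #|T| * #|T|%:R < (edges_in G T)%:R]]) _) _.
  move=> G /existsP[T /andP[TS W]].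
  have [PT|PT] := boolP (P #|T|); last by right; apply/existsP; exists T; rewrite TS PT W.
  have T0 : (0 < #|T|)%N.
    rewrite lt0n cards_eq0; apply: contraTneq W => ->.
    by rewrite /edges_in big_pred0 ?cards0 ?mulr0 ?ltxx // => i; rewrite inE.
  have Tk : (#|T|.-1 < #|S|)%N by rewrite prednK // subset_leq_card.
  left; apply/existsP; exists (Ordinal Tk) => /=; rewrite prednK // PT /=.
  by apply/existsP; exists T; rewrite TS eqxx W.
rewrite lerD2r; apply: le_trans (geometric_tail_le #|S| y01).
apply: le_trans (Pr_exists law_ge0 (P := fun k : 'I_#|S| => P k.+1)
   (B := fun k : 'I_#|S| => A k.+1) _) _.
  by move=> G /existsP[k /andP[Pk Ak]]; exists k.
rewrite big_mkcond; apply: ler_sum => k _; have y0 : 0 <= y by case/andP: y01.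
case: ifP => Pk; last by rewrite exprn_ge0.
apply: le_trans (dense_size_prob (c0 k.+1) (ltn0Sn k)) _.
rewrite lerXn2r ?nnegrE //; last by apply: hy => //=.
by rewrite !mulr_ge0 ?expR_ge0 ?powR_ge0 ?invr_ge0.
Qed.

Definition ordered_pair (u v : 'I_N) := if (u < v)%N then (u, v) else (v, u).

(** Each edge is listed with its smaller endpoint first, matching the index set [i < j] of
    [graph_law]. *)
Definition path_pairs x := [seq ordered_pair e.1 e.2 | e <- zip x (behead x)].

Lemma path_pairs_cons a b x : path_pairs [:: a, b & x] = ordered_pair a b :: path_pairs (b :: x).
Proof. by []. Qed.

Lemma path_pairs_sub x : {in path_pairs x, forall e : 'I_N * 'I_N, (e.1 \in x) && (e.2 \in x)}.
Proof.
elim: x => [|a [|b x] IH] //= e; rewrite inE => /orP[/eqP->|/IH].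
  by rewrite /ordered_pair; case: ifP; rewrite /= !inE !eqxx !orbT.
by rewrite !(in_cons a) => /andP[-> ->]; rewrite !orbT.
Qed.

Lemma path_pairs_uniq x : uniq x -> uniq (path_pairs x).
Proof.
elim: x => [|a [|b x] IH] // /andP[ax Ux]; rewrite path_pairs_cons cons_uniq IH // andbT.
apply/negP => /path_pairs_sub; rewrite /ordered_pair.
by case: ifP => _ /= /andP[]; rewrite (negbTE ax).
Qed.

Lemma path_pairs_lt x : uniq x -> {in path_pairs x, forall e : 'I_N * 'I_N, (e.1 < e.2)%N}.
Proof.
elim: x => [|a [|b x] IH] // /andP[ax Ux] e; rewrite path_pairs_cons inE => /orP[/eqP->|/IH->//].
rewrite /ordered_pair; case: (ltnP a b) => //= ba; rewrite ltn_neqAle ba andbT.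
by apply: contraNneq ax => /val_inj <-; rewrite inE eqxx.
Qed.

Lemma path_pairs_adj G x : sorted (adj G) x -> {in path_pairs x, forall e : 'I_N * 'I_N, adj G e.1 e.2}.
Proof.
elim: x => [|a [|b x] IH] //= /andP[ab bx] e; rewrite inE => /orP[/eqP->|]; last exact: IH.
by rewrite /ordered_pair; case: ifP => //= _; rewrite adjC.
Qed.

Lemma size_path_pairs x : size (path_pairs x) = (size x).-1.
Proof. by rewrite size_map size_zip size_behead; case: x => //= a x; apply/minn_idPr. Qed.

Lemma prod_path_pairs x (a : R) : uniq x ->
  \prod_(i < N) \prod_(j < N | (i < j)%N) (if (i, j) \in path_pairs x then a else 1) =
  a ^+ (size x).-1.
Proof.
move=> Ux; rewrite pair_big_dep /= -size_path_pairs -(card_uniqP (path_pairs_uniq Ux)).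
transitivity (\prod_(e in path_pairs x) a); last by rewrite prodr_const.
rewrite big_mkcond [RHS]big_mkcond; apply: eq_bigr => -[i j] _ /=.
by case: ifP => // ij; case: ifP => // /(path_pairs_lt Ux); rewrite /= ij.
Qed.

(** The [size x - 1] path edges must be present, at cost [p1] each, and at least two further edges
    must lie inside the vertex set; the Chernoff bound for these gives [expR (- s) ^ 2], since the
    tilt of the path edges cancels. *)
Lemma traceable_prob_tilted x (s : R) : uniq x -> {subset x <= S} -> (0 < size x)%N -> 0 <= s ->
  Pr law (fun G => sorted (adj G) x && (size x < edges_in G [set u in x])%N) <=
  p1 ^+ (size x).-1 * expR (- s) ^+ 2 * expR (p1 * (expR s - 1) * (size x)%:R ^+ 2 / 2).
Proof.
move=> Ux xS x0 s0; set X := [set u in x].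
have cX : #|X| = size x by rewrite cardsE (card_uniqP Ux).
have XS : X \subset S by apply/fintype.subsetP => u; rewrite inE => /xS.
have pX i j : (i, j) \in path_pairs x -> both X i j.
  by move=> /path_pairs_sub; rewrite /both !inE.
have es1 : 1 <= expR s by rewrite -[leLHS]expR0 ler_expR.
(* Both requirements in one product: an absent path edge makes it vanish, and each present edge
   inside [X] has weight [expR s]. *)
pose g i j (a : bool) : R :=
  if (i, j) \in path_pairs x then (if a then expR s else 0)
  else expR (s * (both X i j && a)%:R).
apply: (@le_trans _ _ (Ex law (fun G => expR (- s) ^+ (size x).+1 *
    \prod_(i < N) \prod_(j < N | (i < j)%N) g i j (adj G i j)))).
  apply: Pr_le_Ex => [//|G|G].
    rewrite mulr_ge0 ?exprn_ge0 ?expR_ge0 //.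
    apply: prodr_ge0 => i _; apply: prodr_ge0 => j _; rewrite /g.
    by case: ifP => _; rewrite ?expR_ge0 //; case: (adj G i j); rewrite ?expR_ge0.
  move=> /andP[sx W].
  rewrite (_ : \prod_(i < N) _ = expR (s * (edges_in G X)%:R)); last first.
    rewrite expR_edges_in; apply: eq_bigr => i _; apply: eq_bigr => j _; rewrite /g.
    by case: ifP => // ij; rewrite (path_pairs_adj sx ij) (pX _ _ ij) mulr1.
  rewrite -expRM_natl -expRD -[leLHS]expR0 ler_expR mulrN mulrC addrC -mulrBr.
  by rewrite mulr_ge0 // subr_ge0 ler_nat.
rewrite ExZ (Ex_prod _ g).
apply: (@le_trans _ _ (expR (- s) ^+ (size x).+1 * ((p1 * expR s) ^+ (size x).-1 *
    expR (p1 * (expR s - 1) * (size x)%:R ^+ 2 / 2)))); last first.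
  rewrite le_eqVlt; apply/orP; left; apply/eqP; rewrite mulrA; congr (_ * _).
  rewrite exprMn mulrCA; congr (_ * _).
  rewrite -[in LHS](prednK x0) -addn2 addnC exprD -mulrA -exprMn -expRD addNr expR0 expr1n mulr1.
  by [].
rewrite ler_wpM2l ?exprn_ge0 ?expR_ge0 // -(prod_path_pairs _ Ux).
pose h i j : R := if both X i j then expR (p1 * (expR s - 1)) else 1.
apply: (@le_trans _ _ (\prod_(i < N) \prod_(j < N | (i < j)%N)
   ((if (i, j) \in path_pairs x then p1 * expR s else 1) * h i j))); last first.
  under eq_bigr => i _ do rewrite big_split /=.
  rewrite big_split /= ler_wpM2l //.
    apply: prodr_ge0 => i _; apply: prodr_ge0 => j _; case: ifP => // _.
    by rewrite mulr_ge0 ?expR_ge0 // ltW.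
  rewrite -cX; apply: prod_pairs_in_le => [|i j]; first by rewrite mulr_ge0 ?subr_ge0 // ltW.
  by rewrite /h -/(both X i j) lexx andbT; case: ifP => _; rewrite ?expR_ge0 ?ler01.
have q0 i j : 0 <= (if (i \in S) && (j \in S) then p1 else p0) <= 1.
  by case: ifP => _; rewrite ?p0_ge0 ?p1_le1 ?(ltW p1_gt0) // (le_trans (ltW p01)).
have g0 i j a : 0 <= g i j a by rewrite /g; case: ifP => _; rewrite ?expR_ge0 //; case: a; rewrite ?expR_ge0.
have E0 i j : 0 <= (if (i \in S) && (j \in S) then p1 else p0) * g i j true +
   (1 - (if (i \in S) && (j \in S) then p1 else p0)) * g i j false.
  by have /andP[a b] := q0 i j; rewrite addr_ge0 // mulr_ge0 // subr_ge0.
apply: ler_prod => i _; rewrite prodr_ge0 //=; apply: ler_prod => j _.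
rewrite E0 /= /g /h; case: (boolP ((i, j) \in path_pairs x)) => ij.
  rewrite (planted_inside XS (pX _ _ ij)) (pX _ _ ij) mulr0 addr0.
  rewrite ler_peMr //; first by rewrite mulr_ge0 ?expR_ge0 // ltW.
  by rewrite -[leLHS]expR0 ler_expR mulr_ge0 ?subr_ge0 // ltW.
rewrite mul1r; case: (boolP (both X i j)) => [bX|_]; last first.
  by rewrite mulr0 expR0 !mulr1 addrC subrK.
rewrite (planted_inside XS bX) mulr1 mulr0 expR0 mulr1.
by apply: le_trans (expR_ge1Dx _); rewrite mulrBr mulr1 addrC addrAC addrA.
Qed.

(** Take [expR (- s) = p1 l ^ 2], of the order of the expected number of chords; the factor [l ^ 4]
    reflects the number of positions for two chords. If [p1 l ^ 2 > 1], the presence of the path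
    alone suffices. *)
Lemma traceable_prob x : uniq x -> {subset x <= S} -> (0 < size x)%N ->
  Pr law (fun G => sorted (adj G) x && (size x < edges_in G [set u in x])%N) <=
  expR (1 / 2) * (p1 ^+ (size x).+1 * (size x)%:R ^+ 4).
Proof.
move=> Ux xS x0; set l := size x.
have l0 : 0 < l%:R :> R by rewrite ltr0n.
have pl : 0 < p1 * l%:R ^+ 2 by rewrite mulr_gt0 // exprn_gt0.
have E : p1 ^+ l.-1 * (p1 * l%:R ^+ 2) ^+ 2 = p1 ^+ l.+1 * l%:R ^+ 4.
  by rewrite -[in X in p1 ^+ X.+1](prednK x0 : l.-1.+1 = l) !exprS; ring.
have [h|h] := leP (p1 * l%:R ^+ 2) 1.
  have s0 : 0 <= - ln (p1 * l%:R ^+ 2) by rewrite oppr_ge0 ln_le0.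
  apply: le_trans (traceable_prob_tilted Ux xS x0 s0) _.
  rewrite opprK expRN lnK // -/l E mulrC ler_wpM2r ?mulr_ge0 ?exprn_ge0 ?(ltW p1_gt0) //.
  rewrite ler_expR ler_pM2r ?invr_gt0 // mulrAC mulrBr mulr1 mulfV ?gt_eqF //.
  by rewrite gerBl ltW.
apply: le_trans (traceable_prob_tilted Ux xS x0 (lexx 0)) _.
rewrite oppr0 expR0 subrr mulr0 !mul0r expR0 expr1n !mulr1 -/l -E mulrCA.
rewrite ler_peMr ?exprn_ge0 ?(ltW p1_gt0) // -[leLHS]mulr1 ler_pM //.
  by rewrite -[leLHS]expR0 ler_expR.
by rewrite exprn_ege1 // ltW.
Qed.

(** There are at most [#|S| ^ l] vertex sequences of length [l], against a probability of order
    [p1 ^ (l + 1) * l ^ 4]. The extra factor [p1] makes the bound vanish while [#|S| * p1] stays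
    away from 1. *)
Lemma overdense1_prob : Pr law (overdense (fun=> 1 : R) S) <= expR (1 / 2) * p1 *
  \sum_(l < #|S|) (#|S|%:R * p1) ^+ l.+1 * l.+1%:R ^+ 4.
Proof.
(* Paths are represented by finite functions, for which counting is immediate; those with repeated
   vertices are ruled out inside the event [B]. *)
rewrite mulr_sumr.
pose seq_of l (f : {ffun 'I_l -> 'I_N}) : seq 'I_N := [seq f i | i <- enum 'I_l].
have size_of l f : size (@seq_of l f) = l by rewrite size_map size_enum_ord.
pose B l (f : {ffun 'I_l -> 'I_N}) (G : sgraph N) := [&& uniq (seq_of l f),
  sorted (adj G) (seq_of l f) & (l < edges_in G [set u in seq_of l f])%N].
pose A (l : 'I_#|S|) (G : sgraph N) := [exists f in ffun_on (mem S), @B l.+1 f G].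
apply: le_trans (Pr_exists law_ge0 (P := xpredT) (B := A) _) _.
  move=> G /existsP[T /andP[TS]]; rewrite mul1r ltr_nat => /exists_traceable.
  case=> x [Ux xT sx x0 Wx].
  have xS : {subset x <= S} by move=> u /xT; apply: (fintype.subsetP TS).
  have lx : (0 < size x)%N by rewrite lt0n size_eq0.
  have ls : ((size x).-1 < #|S|)%N.
    by rewrite prednK // -(card_uniqP Ux) subset_leq_card //; apply/fintype.subsetP.
  exists (Ordinal ls) => //; apply/exists_inP => /=; rewrite prednK //.
  exists [ffun i => tnth (in_tuple x) i].
    by apply/ffun_onP => i; rewrite ffunE xS ?mem_tnth.
  have E : seq_of _ [ffun i => tnth (in_tuple x) i] = x.
    rewrite -[RHS](map_tnth_enum (in_tuple x)); apply: eq_map => i; by rewrite ffunE.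
  by rewrite /B E Ux sx.
apply: ler_sum => l _.
apply: le_trans (Pr_exists law_ge0 (P := fun f => f \in ffun_on (mem S)) (B := @B l.+1) _) _.
  by move=> G /exists_inP[f fS Bf]; exists f.
apply: (@le_trans _ _ (\sum_(f : {ffun 'I_l.+1 -> 'I_N} | f \in ffun_on (mem S))
    expR (1 / 2) * (p1 ^+ l.+2 * l.+1%:R ^+ 4))).
  apply: ler_sum => f /ffun_onP fS.
  have [Uf|Uf] := boolP (uniq (seq_of _ f)); last first.
    rewrite /B (negbTE Uf) /= /Pr big_pred0 // mulr_ge0 ?expR_ge0 //.
    by rewrite mulr_ge0 ?exprn_ge0 // ltW.
  have := @traceable_prob (seq_of _ f) Uf; rewrite size_of => H.
  rewrite /B Uf; apply: H => // u /mapP[i _ ->]; exact: fS.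
rewrite sumr_const card_ffun_on card_ord -[_ *+ _]mulr_natl natrX.
by rewrite le_eqVlt; apply/orP; left; apply/eqP; rewrite [p1 ^+ l.+2]exprS exprMn; ring.
Qed.

End FirstMoments.

(** * Concentration of the maximal number of edges *)

Section EfronStein.
Variables (R : realType) (E : finType) (q : E -> R).
Hypothesis q01 : forall e, 0 <= q e <= 1.
Implicit Types (x y : {ffun E -> bool}) (f g : {ffun E -> bool} -> R) (e : E) (s : seq E).

Definition upd x e (b : bool) : {ffun E -> bool} := [ffun e' => if e' == e then b else x e'].

Lemma upd_upd x e b b' : upd (upd x e b) e b' = upd x e b'.
Proof. by apply/ffunP => a; rewrite !ffunE; case: eqP. Qed.

Lemma updC x e e' b b' : e != e' -> upd (upd x e b) e' b' = upd (upd x e' b') e b.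
Proof.
move=> ee; apply/ffunP => a; rewrite !ffunE; case: (eqVneq a e') => // ->.
by rewrite eq_sym (negbTE ee).
Qed.

Lemma upd_id x e : upd x e (x e) = x.
Proof. by apply/ffunP => a; rewrite ffunE; case: eqP => // ->. Qed.

(** Conditional expectation of [f] given all coordinates except [e]. *)
Definition average e f x : R := q e * f (upd x e true) + (1 - q e) * f (upd x e false).

Definition averages s f := foldr average f s.

Definition product_law x : R := \prod_e bernoulli_pmf (q e) (x e).

Let q_ge0 e : 0 <= q e. Proof. by case/andP: (q01 e). Qed.
Let q_compl_ge0 e : 0 <= 1 - q e. Proof. by rewrite subr_ge0; case/andP: (q01 e). Qed.

Lemma product_law_ge0 x : 0 <= product_law x.
Proof. by apply: prodr_ge0 => e _; apply: bernoulli_pmf_ge0. Qed.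

Lemma product_law_sum : \sum_x product_law x = 1.
Proof.
rewrite -(bigA_distr_bigA (fun e b => bernoulli_pmf (q e) b)) big1 // => e _.
by rewrite big_bool /= addrC subrK.
Qed.

Lemma Ex_average e f : Ex product_law (average e f) = Ex product_law f.
Proof.
pose flip x := upd x e (~~ x e).
have flipK : involutive flip.
  by move=> x; rewrite /flip upd_upd ffunE eqxx negbK upd_id.
have split_sum (h : {ffun E -> bool} -> R) :
    \sum_x h x = \sum_(x : {ffun E -> bool} | x e) (h (upd x e true) + h (upd x e false)).
  rewrite (bigID (fun x : {ffun E -> bool} => x e)) /= [X in _ + X](reindex_inj (inv_inj flipK)) /=.
  rewrite [X in _ + X](eq_bigl (fun x : {ffun E -> bool} => x e)); last first.
    by move=> x; rewrite /flip ffunE eqxx negbK.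
  rewrite -big_split /=; apply: eq_bigr => x xe.
  by rewrite /flip xe /= -{1}[x](upd_id _ e) xe.
rewrite /Ex [LHS]split_sum [RHS]split_sum; apply: eq_bigr => x _.
have lawE b : product_law (upd x e b) =
    bernoulli_pmf (q e) b * \prod_(e' | e' != e) bernoulli_pmf (q e') (x e').
  rewrite /product_law (bigD1 e) //= ffunE eqxx; congr (_ * _).
  by apply: eq_bigr => e' /negbTE ee; rewrite ffunE ee.
by rewrite /average !upd_upd !lawE /=; ring.
Qed.

Lemma Ex_averages s f : Ex product_law (averages s f) = Ex product_law f.
Proof. by elim: s => //= e s IH; rewrite Ex_average. Qed.

Lemma averages_upd_mem s f x e b : e \in s -> averages s f (upd x e b) = averages s f x.
Proof.
elim: s x => //= a s IH x; rewrite inE /average; case: (eqVneq e a) => [->|ea] /=.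
  by rewrite !upd_upd.
by move=> es; rewrite !(updC _ _ _ ea) !IH.
Qed.

Lemma averages_upd_notin s f x e b : e \notin s ->
  averages s f (upd x e b) = averages s (fun y => f (upd y e b)) x.
Proof.
elim: s x => //= a s IH x; rewrite inE negb_or /average => /andP[ea es].
by rewrite !(updC _ _ _ ea) !IH.
Qed.

(** Averaging over every coordinate leaves a constant function. Variances can thus be handled by
    induction on a list of coordinates at a fixed point [x]. *)
Lemma Ex_averagesE f x : Ex product_law f = averages (enum E) f x.
Proof.
rewrite -(Ex_averages (enum E)).
rewrite -[RHS](Ex_cst product_law_sum); apply: eq_bigr => y _; congr (_ * _).
have H s : averages (enum E) f [ffun e => if e \in s then x e else y e] =
           averages (enum E) f y.
  elim: s => [|e s IH].
    by congr averages; apply/ffunP => e; rewrite ffunE.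
  rewrite -IH -[RHS](averages_upd_mem f _ (x e) (_ : e \in enum E)) ?mem_enum //; congr averages.
  by apply/ffunP => a; rewrite !ffunE inE; case: eqP => //= ->.
rewrite -(H (enum E)); congr averages; apply/ffunP => e.
by rewrite ffunE mem_enum.
Qed.

Lemma sqr_averages_le s f x : averages s f x ^+ 2 <= averages s (fun y => f y ^+ 2) x.
Proof.
elim: s x => [//|e s IH] x /=; rewrite /average.
have := IH (upd x e true); have := IH (upd x e false).
set u := averages s f (upd x e true); set v := averages s f (upd x e false).
set a := averages s _ (upd x e false); set b := averages s _ (upd x e true) => h1 h2.
have : q e * u ^+ 2 <= q e * b by rewrite ler_wpM2l.
have : (1 - q e) * v ^+ 2 <= (1 - q e) * a by rewrite ler_wpM2l.
have : 0 <= q e * (1 - q e) * (u - v) ^+ 2 by rewrite mulr_ge0 ?sqr_ge0 // mulr_ge0.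
move: (q e) => p; nra.
Qed.

Definition local_variance e f x : R :=
  q e * (1 - q e) * (f (upd x e true) - f (upd x e false)) ^+ 2.

Lemma averagesB s f g x :
  averages s (fun y => f y - g y) x = averages s f x - averages s g x.
Proof. by elim: s x => //= e s IH x; rewrite /average !IH; ring. Qed.

Lemma averagesZ s a f x : averages s (fun y => a * f y) x = a * averages s f x.
Proof. by elim: s x => //= e s IH x; rewrite /average !IH; ring. Qed.

(** Variance decomposition for one more coordinate [a]: the mean over [a] of the variance in [s],
    plus the variance in [a] of the average over [s]. By Jensen the latter is at most the average of
    the local variance. *)
Lemma averages_variance s f x : uniq s ->
  averages s (fun y => f y ^+ 2) x - averages s f x ^+ 2 <=
  \sum_(e <- s) averages s (local_variance e f) x.
Proof.
elim: s x => [|a s IH] x; first by rewrite big_nil /= subrr.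
move=> /= /andP[anots Us]; rewrite big_cons /=.
have stepV : \sum_(e <- s) average a (averages s (local_variance e f)) x =
    average a (fun y => \sum_(e <- s) averages s (local_variance e f) y) x.
  by rewrite /average !mulr_sumr -big_split.
have Va : average a (averages s (local_variance a f)) x = averages s (local_variance a f) x.
  rewrite /average !averages_upd_notin //.
  have Eb b : (fun y => local_variance a f (upd y a b)) = local_variance a f.
    by apply/funext => y; rewrite /local_variance !upd_upd.
  by rewrite !Eb; ring.
have Jensen : q a * (1 - q a) *
     (averages s f (upd x a true) - averages s f (upd x a false)) ^+ 2 <=
     averages s (local_variance a f) x.
  rewrite !averages_upd_notin // -averagesB /local_variance averagesZ.
  by rewrite ler_wpM2l ?sqr_averages_le // mulr_ge0.
rewrite stepV Va.
have h1 := IH (upd x a true) Us; have h0 := IH (upd x a false) Us.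
have k1 := ler_wpM2l (q_ge0 a) h1; have k0 := ler_wpM2l (q_compl_ge0 a) h0.
apply: le_trans (lerD Jensen (lerD k1 k0)).
rewrite /average le_eqVlt; apply/orP; left; apply/eqP; ring.
Qed.

Lemma efron_stein f : Ex product_law (fun x => f x ^+ 2) - Ex product_law f ^+ 2 <=
  \sum_e Ex product_law (local_variance e f).
Proof.
pose x0 : {ffun E -> bool} := [ffun=> true].
rewrite !(Ex_averagesE _ x0); under eq_bigr => e _ do rewrite (Ex_averagesE _ x0).
by rewrite -big_enum /=; apply: averages_variance; apply: enum_uniq.
Qed.

(** An increment [d] in [[0, 1]] gives [q (1 - q) d ^ 2 <= q d], and [q d] is the mean loss when the
    coordinate is set to [false]. These losses add up to at most [f]. *)
Lemma self_bounding_variance f :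
  (forall x e, 0 <= f (upd x e true) - f (upd x e false) <= 1) ->
  (forall x, \sum_e (f x - f (upd x e false)) <= f x) ->
  Ex product_law (fun x => f x ^+ 2) - Ex product_law f ^+ 2 <= Ex product_law f.
Proof.
move=> f01 fsum; apply: le_trans (efron_stein f) _.
apply: (@le_trans _ _ (\sum_e Ex product_law (fun x => f x - f (upd x e false)))); last first.
  by rewrite -Ex_sum; apply: Ex_le => // x; apply: product_law_ge0.
apply: ler_sum => e _; rewrite -(Ex_average e (fun x => f x - f (upd x e false))).
apply: Ex_le => x; first exact: product_law_ge0.
rewrite /average /local_variance !upd_upd subrr mulr0 addr0 -mulrA ler_wpM2l //.
have /andP[] := f01 x e; move: (f _ - f _) => d d0 d1.
have := q_ge0 e; have := q_compl_ge0 e; move: (q e) => p; nra.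
Qed.

End EfronStein.

(** * Variance and relabelling invariance of the maximal number of edges *)

Section MaxEdges.
Variables (R : realType) (N : nat).
Implicit Types (S T : {set 'I_N}) (G : sgraph N) (x : {ffun edge N -> bool}).

Lemma edges_in_graph_of x T :
  edges_in (graph_of x) T = (\sum_(e : edge N) (both T (val e).1 (val e).2 && x e))%N.
Proof.
rewrite edges_in_pairs pair_big_dep /=.
transitivity (\sum_(e : edge N)
   (both T (val e).1 (val e).2 && adj (graph_of x) (val e).1 (val e).2))%N.
  by rewrite -(big_sub (fun e : 'I_N * 'I_N => (e.1 < e.2)%N)
     (fun e => both T e.1 e.2 && adj (graph_of x) e.1 e.2 : nat)).
by apply: eq_bigr => e _; rewrite adj_graph_of.
Qed.

Lemma edges_in_le_max k S T G : T \subset S -> #|T| = k ->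
  (edges_in G T <= max_edges_in k S G)%N.
Proof. by move=> TS Tk; apply: leq_bigmax_cond; rewrite TS Tk eqxx. Qed.

Lemma max_edges_in_attained k S G : max_edges_in k S G = 0%N \/
  exists T, [/\ T \subset S, #|T| = k & max_edges_in k S G = edges_in G T].
Proof.
rewrite /max_edges_in.
case: (pickP (fun T : {set 'I_N} => (T \subset S) && (#|T| == k))) => [T0 P0|P0].
  right; rewrite (mathcomp.boot.bigop.bigmax_eq_arg T0 P0); case: arg_maxnP => // T /andP[TS /eqP Tk] _.
  by exists T.
by left; rewrite big_pred0.
Qed.

Lemma edges_in_upd x (e : edge N) T : (edges_in (graph_of x) T <=
  edges_in (graph_of (upd x e false)) T + (both T (val e).1 (val e).2 && x e))%N.
Proof.
rewrite !edges_in_graph_of (bigD1 e) //= [X in (_ <= X + _)%N](bigD1 e) //=.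
rewrite ffunE eqxx andbF add0n addnC leq_add2r leq_sum // => a /negbTE ae.
by rewrite ffunE ae.
Qed.

Lemma edges_in_graph_of_mono x (y : {ffun edge N -> bool}) T : (forall e, x e -> y e) ->
  (edges_in (graph_of x) T <= edges_in (graph_of y) T)%N.
Proof.
move=> xy; rewrite !edges_in_graph_of; apply: leq_sum => e _.
by case: (both _ _ _) => //=; case: (boolP (x e)) => [/xy->|_].
Qed.

Lemma edges_in_upd_mono x (e : edge N) T :
  (edges_in (graph_of (upd x e false)) T <= edges_in (graph_of (upd x e true)) T)%N.
Proof.
have H a : upd x e false a -> upd x e true a.
  rewrite /upd.
  rewrite !ffunE.
  by case: ifP.
exact: (@edges_in_graph_of_mono (upd x e false) (upd x e true) T H).
Qed.

(** Self-bounding property: deleting an edge lowers the maximum by at most 1, and only if the edge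
    lies in a fixed maximiser [T]; there are [edges_in G T] such edges, which is the maximum
    itself. *)
Lemma max_edges_in_variance (q : 'I_N -> 'I_N -> R) k S : (forall i j, 0 <= q i j <= 1) ->
  Ex (graph_law q) (fun G => (max_edges_in k S G)%:R ^+ 2) -
  Ex (graph_law q) (fun G => (max_edges_in k S G)%:R) ^+ 2 <=
  Ex (graph_law q) (fun G => (max_edges_in k S G)%:R).
Proof.
move=> q01; pose F G : R := (max_edges_in k S G)%:R; rewrite !Ex_graph_law.
have F01 x (e : edge N) :
    0 <= F (graph_of (upd x e true)) - F (graph_of (upd x e false)) <= 1.
  rewrite /F; apply/andP; split.
    rewrite subr_ge0 ler_nat; apply/bigmax_leqP => T /andP[TS /eqP Tk].
    apply: leq_trans (edges_in_le_max _ TS Tk).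
    exact: edges_in_upd_mono.
  rewrite lerBlDl natr1 ler_nat; apply/bigmax_leqP => T /andP[TS /eqP Tk].
  apply: leq_trans (edges_in_upd _ e T) _; rewrite upd_upd -addn1 leq_add ?leq_b1 //.
  exact: edges_in_le_max.
have Fsum x : \sum_(e : edge N) (F (graph_of x) - F (graph_of (upd x e false))) <= F (graph_of x).
  rewrite /F; have [F0|[T [TS Tk FT]]] := max_edges_in_attained k S (graph_of x).
    by rewrite F0; apply: sumr_le0 => e _; rewrite sub0r oppr_le0.
  rewrite {2}FT edges_in_graph_of natr_sum; apply: ler_sum => e _.
  rewrite lerBlDl -natrD ler_nat {1}FT; apply: leq_trans (edges_in_upd _ e T) _.
  by rewrite leq_add2r edges_in_le_max.
exact: (@self_bounding_variance R _ (fun e : edge N => q (val e).1 (val e).2)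
  (fun e => q01 (val e).1 (val e).2) (fun x => F (graph_of x)) F01 Fsum).
Qed.

Lemma max_edges_in_mono S G k k' : (k <= k')%N -> (k' <= #|S|)%N ->
  (max_edges_in k S G <= max_edges_in k' S G)%N.
Proof.
move=> kk'; rewrite -(subnKC kk'); elim: (k' - k)%N => [|d IH] kd; first by rewrite addn0.
apply: leq_trans (IH _) _; first by rewrite (leq_trans _ kd) // leq_add2l.
apply/bigmax_leqP => T /andP[TS /eqP Tk].
have : T \proper S by rewrite properEcard TS Tk -addnS kd.
case/properP => _ [v vS vT].
apply: (@leq_trans (edges_in G (v |: T))).
  by apply: edges_in_mono; apply: finset.subsetUr.
apply: edges_in_le_max; last by rewrite cardsU1 vT Tk addnS add1n.
by rewrite finset.subUset finset.sub1set vS.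
Qed.

(** Relabelling the vertices transports the planted law of one set to another. Case 4 assumes a
    bound for one set per [N], whereas the prior requires it for all sets of size [n]. *)
Definition relabel_mx (s : {perm 'I_N}) G : 'M[bool]_N := \matrix_(i, j) adj G (s i) (s j).

Lemma relabel_adjacency s G : is_adjacency (relabel_mx s G).
Proof.
apply/andP; split.
  by apply/forallP => i; apply/forallP => j; rewrite !mxE adjC.
by apply/forallP => i; rewrite mxE adjii.
Qed.

Definition relabel s G := SGraph (relabel_adjacency s G).

Lemma adj_relabel s G i j : adj (relabel s G) i j = adj G (s i) (s j).
Proof. by rewrite mxE. Qed.

Lemma relabelK s : cancel (relabel s) (relabel s^-1).
Proof. by move=> G; apply: adj_inj => i j _; rewrite !adj_relabel !permKV. Qed.

Lemma relabel_inj s : injective (relabel s).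
Proof. exact: can_inj (relabelK s). Qed.

(** A permutation does not preserve [i < j]; reordering each image pair repairs this, and the
    symmetry of [F] makes the reordering harmless. *)
Lemma prod_pairs_perm (s : {perm 'I_N}) (F : 'I_N -> 'I_N -> R) : (forall i j, F i j = F j i) ->
  \prod_(i < N) \prod_(j < N | (i < j)%N) F (s i) (s j) =
  \prod_(i < N) \prod_(j < N | (i < j)%N) F i j.
Proof.
move=> FC; rewrite !pair_big_dep /=.
pose h (t : {perm 'I_N}) (e : 'I_N * 'I_N) := ordered_pair (t e.1) (t e.2).
have hlt (t : {perm 'I_N}) (e : 'I_N * 'I_N) : e.1 != e.2 -> ((h t e).1 < (h t e).2)%N.
  move=> ee; rewrite /h /ordered_pair; case: (ltnP (t e.1) (t e.2)) => //= le.
  rewrite ltn_neqAle le andbT; apply: contraNneq ee => /val_inj /perm_inj ->; exact: eqxx.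
have hK (t : {perm 'I_N}) (e : 'I_N * 'I_N) : (e.1 < e.2)%N -> h t^-1%g (h t e) = e.
  move=> lt; rewrite /h /ordered_pair; case: (ltnP (t e.1) (t e.2)) => _ /=; rewrite !permK.
    by rewrite lt -surjective_pairing.
  by rewrite ltnNge (ltnW lt) -surjective_pairing.
rewrite [RHS](reindex_onto (h s) (h s^-1%g)) /=; last first.
  by move=> e lt; have := hK s^-1%g e lt; rewrite invgK.
apply: eq_big => [e|e _]; last first.
  by rewrite /h /ordered_pair; case: ifP.
case: (ltngtP e.1 e.2) => [lt|gt|eq].
- by rewrite hK // eqxx andbT hlt // neq_ltn lt.
- apply/esym/negbTE; apply/negP => /andP[_ /eqP E].
  have : ((h s^-1%g (h s e)).1 < (h s^-1%g (h s e)).2)%N.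
    by rewrite hlt // neq_ltn hlt // neq_ltn gt orbT.
  by rewrite E ltnNge ltnW.
- apply/esym/negbTE; rewrite negb_and; apply/orP; left.
  by rewrite /h (val_inj eq) /ordered_pair ltnn /= ltnn.
Qed.

Lemma planted_law_relabel (p0 p1 : R) (s : {perm 'I_N}) S G :
  planted_law p0 p1 S (relabel s G) = planted_law p0 p1 (s @: S) G.
Proof.
pose F i j := bernoulli_pmf
  (if (i \in s @: S) && (j \in s @: S) then p1 else p0) (adj G i j).
rewrite [RHS](_ : _ = \prod_(i < N) \prod_(j < N | (i < j)%N) F i j) //.
rewrite -(prod_pairs_perm s); last by move=> i j; rewrite /F andbC adjC.
apply: eq_bigr => i _; apply: eq_bigr => j _; rewrite /F adj_relabel.
by rewrite !(mem_imset _ _ perm_inj).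
Qed.

Lemma edges_in_relabel s G T : edges_in (relabel s G) T = edges_in G (s @: T).
Proof.
apply/eqP; rewrite -(eqn_pmul2l (m := 2)) // -!sum_degree; apply/eqP.
rewrite big_imset /=; last by move=> ? ? _ _; apply: perm_inj.
apply: eq_bigr => v _; rewrite !degreeE big_imset /=; last by move=> ? ? _ _; apply: perm_inj.
by apply: eq_bigr => u _; rewrite adj_relabel.
Qed.

Lemma max_edges_in_relabel s G k S :
  max_edges_in k S (relabel s G) = max_edges_in k (s @: S) G.
Proof.
rewrite /max_edges_in [RHS](reindex_inj (imset_inj (@perm_inj _ s))) /=.
apply: eq_big => [T|T _]; last exact: edges_in_relabel.
rewrite card_imset; last exact: perm_inj.
congr (_ && _); apply/idP/idP => [|H]; first exact: imsetS.
apply/fintype.subsetP => u uT; rewrite -(mem_imset _ _ (@perm_inj _ s)).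
by apply: (fintype.subsetP H); apply: imset_f.
Qed.

Lemma Ex_max_edges_perm (p0 p1 : R) k (s : {perm 'I_N}) S :
  Ex (planted_law p0 p1 (s @: S)) (fun G => (max_edges_in k (s @: S) G)%:R) =
  Ex (planted_law p0 p1 S) (fun G => (max_edges_in k S G)%:R).
Proof.
rewrite /Ex [RHS](reindex_inj (@relabel_inj s)) /=; apply: eq_bigr => G _.
by rewrite planted_law_relabel max_edges_in_relabel.
Qed.

(** A transposition exchanging a point of [S :\: T] with a point of [T :\: S] brings [S] one step
    closer to [T]. *)
Lemma Ex_max_edges_card (p0 p1 : R) k S T : #|S| = #|T| ->
  Ex (planted_law p0 p1 S) (fun G => (max_edges_in k S G)%:R) =
  Ex (planted_law p0 p1 T) (fun G => (max_edges_in k T G)%:R).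
Proof.
have [m] := ubnP #|S :\: T|; elim: m S => // m IH S lem cST.
have [ST|] := boolP (S \subset T).
  have /eqP -> // : S == T.
  by rewrite eqEcard ST cST /=.
case/fintype.subsetPn => a aS aT.
have [b bT bS] : exists2 b, b \in T & b \notin S.
  apply/fintype.subsetPn; apply: contra aT => TS.
  have /eqP -> // : T == S.
  by rewrite eqEcard TS cST /=.
rewrite -(Ex_max_edges_perm _ _ _ (tperm a b)).
have ab : a != b by apply: contraNneq aT => ->.
have EU : tperm a b @: S = b |: (S :\ a).
  apply/setP => u; rewrite -{1}[u](tpermK a b) (mem_imset _ _ perm_inj) !inE.
  case: tpermP => [->|->|/eqP ua /eqP ub].
  - by rewrite eqxx (negbTE bS) (negbTE ab).
  - by rewrite eqxx aS.
  - by rewrite ua (negbTE ub).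
apply: IH; last by rewrite card_imset //; apply: perm_inj.
rewrite -ltnS; apply: leq_trans lem; rewrite ltnS; apply: proper_card.
rewrite EU; apply/properP; split.
  apply/fintype.subsetP => u; rewrite !inE => /andP[uT /orP[/eqP ub|/andP[_ ->]]]; last by rewrite uT.
  by rewrite ub bT in uT.
exists a; first by rewrite !inE aS aT.
rewrite !inE eqxx /= orbF negb_and negbK; apply/orP; right.
by apply: contraNneq aT => ->.
Qed.

End MaxEdges.

Section Concentration.
Variables (R : realType) (N : nat) (p0 p1 : R) (S : {set 'I_N}).
Hypotheses (p0_ge0 : 0 <= p0) (p01 : p0 < p1) (p1_le1 : p1 <= 1).
Implicit Types (T : {set 'I_N}) (G : sgraph N).
Let law := @planted_law R N p0 p1 S.

Let q01 i j : 0 <= (if (i \in S) && (j \in S) then p1 else p0) <= 1.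
Proof.
by case: ifP => _; rewrite ?p0_ge0 ?p1_le1 ?(le_trans p0_ge0 (ltW p01)) // (le_trans (ltW p01)).
Qed.

Let law_ge0 G : 0 <= law G. Proof. exact: graph_law_ge0. Qed.
Let law_sum : \sum_G law G = 1. Proof. exact: graph_law_sum. Qed.

Lemma Ex_adj (q : 'I_N -> 'I_N -> R) (i0 j0 : 'I_N) : (i0 < j0)%N ->
  Ex (graph_law q) (fun G => (adj G i0 j0)%:R) = q i0 j0.
Proof.
move=> lt0; pose g i j (a : bool) : R := if (i == i0) && (j == j0) then a%:R else 1.
have gE (F : 'I_N -> 'I_N -> R) : (forall i j, ~~ ((i == i0) && (j == j0)) -> F i j = 1) ->
    \prod_(i < N) \prod_(j < N | (i < j)%N) F i j = F i0 j0.
  move=> F1; rewrite (bigD1 i0) //= [X in _ * X]big1 ?mulr1; last first.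
    by move=> i ii; rewrite big1 // => j _; rewrite F1 // (negbTE ii).
  rewrite (bigD1 j0) //= big1 ?mulr1 // => j /andP[_ jj].
  by rewrite F1 // (negbTE jj) andbF.
transitivity (Ex (graph_law q) (fun G =>
    \prod_(i < N) \prod_(j < N | (i < j)%N) g i j (adj G i j))).
  apply: eq_bigr => G _; rewrite gE /g ?eqxx // => i j /negbTE -> //.
rewrite Ex_prod gE /g ?eqxx /= ?mulr1 ?mulr0 ?addr0 // => i j /negbTE ->.
by rewrite !mulr1 addrC subrK.
Qed.

Lemma Ex_edges_in : Ex law (fun G => (edges_in G S)%:R) = p1 * 'C(#|S|, 2)%:R.
Proof.
(* The edge count of the complete graph writes the binomial coefficient as the same double sum. *)
have adjK : is_adjacency (\matrix_(i < N, j < N) (i != j)).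
  apply/andP; split; first by apply/forallP => i; apply/forallP => j; rewrite !mxE [i == j]eq_sym.
  by apply/forallP => i; rewrite mxE eqxx.
pose K := SGraph adjK.
have -> : 'C(#|S|, 2) = edges_in K S.
  apply/eqP; rewrite -(eqn_pmul2l (m := 2)) // -sum_degree mulnC -[2%N]/(2`!) bin_ffact.
  rewrite -[2`!]/2%N ffactnS ffactn1 (eq_bigr (fun=> #|S|.-1)) ?sum_nat_const // => v vS.
  rewrite (cardsD1 v S) vS /=; apply: eq_card => u.
  by rewrite !inE mxE eq_sym andbC.
transitivity (Ex law (fun G => \sum_(i in S) \sum_(j in S | (i < j)%N) (adj G i j)%:R)).
  apply: eq_bigr => G _; rewrite /edges_in natr_sum; congr (_ * _).
  by apply: eq_bigr => i _; rewrite natr_sum.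
rewrite Ex_sum /edges_in natr_sum mulr_sumr; apply: eq_bigr => i iS.
rewrite Ex_sum natr_sum mulr_sumr; apply: eq_bigr => j /andP[jS ij].
rewrite Ex_adj // iS jS mxE (_ : i != j) ?mulr1 //.
by apply: contraTneq ij => ->; rewrite ltnn.
Qed.

Lemma max_edges_in_all G : max_edges_in #|S| S G = edges_in G S.
Proof.
apply/eqP; rewrite eqn_leq edges_in_le_max // andbT.
by apply/bigmax_leqP => T /andP[TS _]; apply: edges_in_mono.
Qed.

(** Chebyshev with variance at most the mean, hence at most [m k], at deviation [d k]. *)
Lemma max_edges_tail (k : nat) (m d : R) : (0 < k)%N -> 0 < d ->
  Ex law (fun G => (max_edges_in k S G)%:R) <= m * k%:R ->
  Pr law (fun G => (m + d) * k%:R <= (max_edges_in k S G)%:R) <= m / (d ^+ 2 * k%:R).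
Proof.
move=> k0 d0 hm; have kR : 0 < k%:R :> R by rewrite ltr0n.
have dk : 0 < d * k%:R by rewrite mulr_gt0.
set E := Ex _ _ in hm.
apply: le_trans (_ : Pr law (fun G => E + d * k%:R <= (max_edges_in k S G)%:R) <= _).
  by apply: Pr_sub => // G; apply: le_trans; rewrite mulrDl lerD2r.
apply: le_trans (chebyshev_upper law_ge0 law_sum dk erefl) _.
rewrite -/E ler_pdivrMr ?exprn_gt0 //.
apply: le_trans (max_edges_in_variance k S q01) _.
rewrite -/law -/E (le_trans hm) // le_eqVlt; apply/orP; left; apply/eqP; field.
by rewrite !gt_eqF.
Qed.

(* The maxima are increasing in [k], so it is enough to control them along an
   arithmetic progression of step [s]. *)
Lemma dense_large_prob (K s : nat) (m d : R) : (0 < K <= #|S|)%N -> (0 < s)%N -> 0 <= m -> 0 < d ->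
  (forall k, (K <= k <= #|S|)%N -> Ex law (fun G => (max_edges_in k S G)%:R) <= m * k%:R) ->
  Pr law (fun G => [exists T : {set 'I_N}, [&& T \subset S, (K <= #|T|)%N &
     (m + d) * (#|T| + s)%:R < (edges_in G T)%:R]]) <=
  (#|S| %/ s).+2%:R * (m / (d ^+ 2 * K%:R)).
Proof.
move=> /andP[K0 KS] s0 m0 d0 hm.
pose kj j := minn #|S| (K + j * s).
have kjK j : (K <= kj j)%N by rewrite leq_min KS leq_addr.
have kjS j : (kj j <= #|S|)%N by rewrite geq_minl.
pose B (j : 'I_(#|S| %/ s).+2) G := (m + d) * (kj j)%:R <= (max_edges_in (kj j) S G)%:R.
apply: le_trans (Pr_exists law_ge0 (P := xpredT) (B := B) _) _.
  move=> G /existsP[T /and3P[TS KT W]].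
  have TS' : (#|T| <= #|S|)%N by apply: subset_leq_card.
  (* Next grid point: its size lies between [#|T|] and [#|T| + s]. Rounding up allows
     [j = #|S| %/ s + 1], which explains the [.+2] indices. *)
  pose j := ((#|T| - K) %/ s).+1.
  have jlt : (j < (#|S| %/ s).+2)%N.
    by rewrite !ltnS leq_div2r // leq_subLR (leq_trans TS') // leq_addl.
  have dv := divn_eq (#|T| - K) s; have md := ltn_pmod (#|T| - K) s0.
  have k1 : (#|T| <= kj j)%N.
    rewrite leq_min TS' /= -leq_subLR /j mulSn [leqLHS]dv addnC leq_add2r.
    exact: ltnW.
  have k2 : (kj j <= #|T| + s)%N.
    apply: leq_trans (geq_minr _ _) _; rewrite /j mulSn addnCA addnC leq_add2r.
    by rewrite -leq_subRL // [X in (_ <= X)%N]dv leq_addr.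
  exists (Ordinal jlt) => //; rewrite /B /=.
  apply: le_trans (_ : (m + d) * (#|T| + s)%:R <= _).
    by rewrite ler_wpM2l ?ler_nat // addr_ge0 // ltW.
  apply/ltW/(lt_le_trans W); rewrite ler_nat.
  by apply: leq_trans (edges_in_le_max _ TS erefl) _; apply: max_edges_in_mono.
apply: le_trans (_ : \sum_(j < (#|S| %/ s).+2) m / (d ^+ 2 * K%:R) <= _); last first.
  by rewrite sumr_const card_ord mulr_natl.
apply: ler_sum => j _; have kj0 : (0 < kj j)%N by apply: leq_trans (kjK j).
apply: le_trans (max_edges_tail kj0 d0 (hm _ _)) _; first by rewrite kjK kjS.
rewrite ler_wpM2l // lef_pV2 ?posrE ?mulr_gt0 ?exprn_gt0 ?ltr0n //.
by rewrite ler_wpM2l ?ler_nat ?exprn_ge0 // ltW.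
Qed.

End Concentration.

(** * Asymptotics *)

Local Open Scope classical_set_scope.

Section LimitSuperior.
Variable R : realType.
Implicit Types f : nat -> R.

Lemma limn_esup_near f (a : \bar R) : (limn_esup (fun N => (f N)%:E) < a)%E ->
  exists2 b : R, (b%:E < a)%E & \forall N \near \oo, f N <= b.
Proof.
rewrite /limn_esup /limf_esup => /ereal_inf_lt[x [V oV <-{x}]].
have ub N : V N -> ((f N)%:E <= ereal_sup ((fun N => (f N)%:E) @` V))%E.
  by move=> VN; apply: ereal_sup_ubound; exists N.
case: (ereal_sup _) ub => [r|//|] ub ra; last 2 first.
- by case: a ra.
- have [N VN] := filter_ex oV; by have := ub _ VN.
exists r => //; near=> N; rewrite -lee_fin; apply: ub; near: N; exact: oV.
Unshelve. all: by end_near. Qed.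

Lemma limn_einf_near f (a : R) : (a%:E < limn_einf (fun N => (f N)%:E))%E ->
  exists2 b : R, a < b & \forall N \near \oo, b <= f N.
Proof.
rewrite /limn_einf lteNr => H.
have [|b ba nb] := @limn_esup_near (fun N => - f N) (- a)%:E.
  by rewrite [X in (limn_esup X < _)%E](_ : _ = \- (fun N => (f N)%:E))%E.
exists (- b); first by rewrite ltrNr -lte_fin.
by near=> N; rewrite lerNl; near: N.
Unshelve. all: by end_near. Qed.

Lemma cvg0_near_le f (e : R) : f @ \oo --> (0 : R) -> 0 < e ->
  \forall N \near \oo, f N <= e.
Proof.
move=> /cvgrPdist_le h e0; near=> N.
have : `|0 - f N| <= e by near: N; apply: h.
by rewrite sub0r normrN; apply: le_trans; rewrite ler_norm.
Unshelve. all: by end_near. Qed.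

End LimitSuperior.

Section Asymptotics.
Variables (R : realType) (n : nat -> nat) (p0 p1 : nat -> R).
Hypotheses (hp : forall N, 0 <= p0 N /\ p0 N < p1 N /\ p1 N <= 1)
    (hn : n @ \oo --> \oo)
    (hnN : ((n N)%:R / N%:R : R) @[N --> \oo] --> (0 : R))
    (hp0 : N%:R ^+ 2 * p0 N @[N --> \oo] --> +oo%R)
    (hzeta : zeta N (n N) (p0 N) (p1 N) @[N --> \oo] --> (0 : R)).

Lemma p0_near : \forall N \near \oo, 0 < p0 N.
Proof.
have /cvgryPge/(_ 1) h := hp0; near=> N.
have [p00 _] := hp N; rewrite lt_neqAle p00 andbT eq_sym; apply/eqP => E.
have : 1 <= N%:R ^+ 2 * p0 N by near: N.
by rewrite E mulr0 ler10.
Unshelve. all: by end_near. Qed.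

Lemma n_near (m : nat) : \forall N \near \oo, (m <= n N)%N.
Proof. by have /cvgnyPge/(_ m) := hn. Qed.

Lemma ratio_near (e : R) : 0 < e -> \forall N \near \oo, (n N)%:R / N%:R <= e.
Proof. exact: cvg0_near_le. Qed.

Lemma n_le_near : \forall N \near \oo, (0 < n N)%N /\ (n N <= N)%N.
Proof.
near=> N; have N0 : (0 < N)%N by near: N; exists 1%N.
split; first by near: N; apply: n_near.
rewrite -(ler_nat R) -[leRHS]mul1r -ler_pdivrMr ?ltr0n //.
by near: N; apply: ratio_near.
Unshelve. all: by end_near. Qed.

(** What remains for each case: a level [c] that is rarely exceeded under the planted law and for
    which the outer bases vanish uniformly. The bound on [p1] keeps [1 - p0] at least [1 / 2]. *)
Lemma asymptotic_core (c : nat -> nat -> R) :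
  (\forall N \near \oo, p1 N <= 1 / 2) ->
  (forall e, 0 < e -> \forall N \near \oo, forall S : {set 'I_N}, #|S| = n N ->
     Pr (planted_law (p0 N) (p1 N) S) (overdense (c N) S) <= e) ->
  (forall e, 0 < e -> \forall N \near \oo, forall k, (0 < k <= n N)%N ->
     1 < p1 N ^+ 2 / p0 N * k%:R ->
     (n N)%:R ^+ 2 / N%:R / k%:R * (p1 N ^+ 2 / p0 N * k%:R) `^ c N k <= e) ->
  minimax_risk N (n N) (p0 N) (p1 N) @[N --> \oo] --> (1 : R).
Proof.
move=> hp1 hbad hout; apply/cvgrPdist_le => e e0.
pose t := Num.min (1 / 2) (e / 3).
have t0 : 0 < t by rewrite lt_min !divr_gt0.
have t1 : t <= 1 / 2 by rewrite ge_min lexx.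
have te : 3 * t <= e.
  by rewrite mulrC -ler_pdivlMr // ge_min lexx orbT.
have t2 : 0 < t ^+ 2 by rewrite exprn_gt0.
(* Chosen so that [k > A * rho] alone settles the outer condition when [D k <= 1]. *)
pose A := expR (3 / 2) / t ^+ 2.
have A0 : 0 < A by rewrite divr_gt0 ?expR_gt0.
have l0 : 0 < ln (1 + t ^+ 2) by rewrite ln_gt0 // ltrDl.
have z0 : 0 < ln (1 + t ^+ 2) / A ^+ 2 by rewrite divr_gt0 // exprn_gt0.
have o0 : 0 < t ^+ 2 / expR (3 / 2) by rewrite divr_gt0 ?expR_gt0.
near=> N.
have p00 : 0 < p0 N by near: N; apply: p0_near.
have [_ [p01 p1le1]] := hp N.
have p1h : p1 N <= 1 / 2 by near: N.
have p0h : p0 N <= 1 / 2 by rewrite ltW // (lt_le_trans p01).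
have [n0 nN] : (0 < n N)%N /\ (n N <= N)%N by near: N; apply: n_le_near.
have N0 : 0 < N%:R :> R by rewrite ltr0n (leq_trans n0).
have Hbad : forall S : {set 'I_N}, #|S| = n N ->
  Pr (planted_law (p0 N) (p1 N) S) (overdense (c N) S) <= t ^+ 2 by near: N; apply: hbad.
have Hz : zeta N (n N) (p0 N) (p1 N) <= ln (1 + t ^+ 2) / A ^+ 2.
  by near: N; apply: cvg0_near_le.
have Ho : forall k, (0 < k <= n N)%N -> 1 < p1 N ^+ 2 / p0 N * k%:R ->
   (n N)%:R ^+ 2 / N%:R / k%:R * (p1 N ^+ 2 / p0 N * k%:R) `^ c N k <= t ^+ 2 / expR (3 / 2).
  by near: N; apply: hout.
have p0lt1 : p0 N < 1 by rewrite (le_lt_trans p0h) //; lra.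
have Hbulk : expR ((p1 N - p0 N) ^+ 2 / (p0 N * (1 - p0 N)) *
     (A * ((n N)%:R ^+ 2 / N%:R)) ^+ 2 / 2) <= 1 + t ^+ 2.
  rewrite -[leRHS]lnK ?posrE ?addr_gt0 // ler_expR.
  (* The bulk exponent is [zeta] up to constants. *)
  have E : (p1 N - p0 N) ^+ 2 / (p0 N * (1 - p0 N)) * (A * ((n N)%:R ^+ 2 / N%:R)) ^+ 2 / 2 =
    zeta N (n N) (p0 N) (p1 N) * A ^+ 2 * ((1 - p0 N)^-1 / 2).
    by rewrite /zeta; field; rewrite !gt_eqF // subr_gt0.
  rewrite E -[leRHS]mulr1; apply: ler_pM.
  - rewrite mulr_ge0 ?sqr_ge0 // /zeta mulr_ge0 ?divr_ge0 ?sqr_ge0 ?(ltW p00) ?exprn_ge0 //.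
  - by rewrite divr_ge0 // invr_ge0 subr_ge0 ltW.
  - by rewrite -ler_pdivlMr // exprn_gt0.
  - rewrite -invfM invf_le1; first by lra.
    by rewrite mulr_gt0 // subr_gt0.
have Houter : forall k, (0 < k <= n N)%N -> A * ((n N)%:R ^+ 2 / N%:R) < k%:R ->
    (n N)%:R ^+ 2 / N%:R / k%:R * (Num.max 1 (p1 N ^+ 2 / p0 N * k%:R) `^ c N k * expR (3 / 2)) <= t ^+ 2.
  move=> k kn kA; have k0 : 0 < k%:R :> R by rewrite ltr0n; case/andP: kn.
  have [D1|D1] := leP (p1 N ^+ 2 / p0 N * k%:R) 1.
    rewrite powR1 mul1r mulrAC ler_pdivrMr //.
    move: kA; rewrite /A mulrAC ltr_pdivrMr // [t ^+ 2 * _]mulrC => /ltW; apply: le_trans.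
    by rewrite mulrC.
  by rewrite mulrA -ler_pdivlMr ?expR_gt0 //; apply: Ho.
have lo := minimax_risk_ge p00 p0lt1 p01 p1le1 nN t0 t1 Hbad Hbulk Houter.
have up := minimax_risk_le1 p00 p0lt1 p01 p1le1 nN t0 t1 Hbad Hbulk Houter.
rewrite ger0_norm ?subr_ge0 //; lra.
Unshelve. all: by end_near. Qed.

Lemma geometric_sum_le (r : R) m : 0 <= r -> r < 1 ->
  \sum_(l < m) r ^+ l.+1 <= (1 - r)^-1.
Proof.
move=> r0 r1; rewrite -[leRHS]mul1r ler_pdivlMr ?subr_gt0 //.
have -> : (\sum_(l < m) r ^+ l.+1) * (1 - r) = r - r ^+ m.+1.
  elim: m => [|m IH]; first by rewrite big_ord0 expr1 mul0r subrr.
  by rewrite big_ord_recr /= mulrDl IH [r ^+ m.+2]exprS; ring.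
by rewrite lerBlDr (le_trans (ltW r1)) // lerDl exprn_ge0.
Qed.

(** Since [l ^ 4 <= (4 / h) ^ 4 * expR (h l)], the fourth power is absorbed by part of the decay:
    with [h = - ln b / 2] the remaining ratio [b * expR h] is the square root of [b]. *)
Lemma power4_geometric_sum_le (b : R) : 0 < b < 1 -> exists2 C : R, 0 < C &
  forall x m, 0 <= x <= b -> \sum_(l < m) x ^+ l.+1 * l.+1%:R ^+ 4 <= C.
Proof.
move=> /andP[b0 b1]; pose h := - ln b / 2.
have lb : ln b < 0 by rewrite ln_lt0 // b0.
have h0 : 0 < h by rewrite divr_gt0 // oppr_gt0.
pose r := b * expR h.
have rE : r = expR (ln b / 2).
  by rewrite /r -{1}(lnK (_ : b \is Num.pos)) ?posrE // -expRD /h; congr expR; field.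
have r0 : 0 < r by rewrite rE expR_gt0.
have r1 : r < 1 by rewrite rE -[ltRHS]expR0 ltr_expR pmulr_llt0 // invr_gt0.
exists ((4 / h) ^+ 4 * (1 - r)^-1) => [|x m /andP[x0 xb]].
  by rewrite mulr_gt0 ?invr_gt0 ?subr_gt0 // exprn_gt0 // divr_gt0.
apply: le_trans (ler_wpM2l _ (geometric_sum_le m (ltW r0) r1)); last first.
  by rewrite exprn_ge0 // divr_ge0 // ltW.
rewrite mulr_sumr; apply: ler_sum => l _.
have H4 : l.+1%:R ^+ 4 <= (4 / h) ^+ 4 * expR h ^+ l.+1.
  have -> : l.+1%:R ^+ 4 = (4 / h) ^+ 4 * (l.+1%:R * h / 4) ^+ 4.
    by field; rewrite gt_eqF.
  have q0 : 0 <= 4 / h by rewrite divr_ge0 // ltW.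
  rewrite ler_wpM2l ?exprn_ge0 //.
  have -> : expR h ^+ l.+1 = expR (l.+1%:R * h / 4) ^+ 4.
    by rewrite -!expRM_natl; congr expR; field.
  have y0 : 0 <= l.+1%:R * h / 4 by rewrite divr_ge0 // mulr_ge0 // ltW.
  rewrite lerXn2r ?nnegrE ?expR_ge0 //.
  by apply: le_trans (expR_ge1Dx _); rewrite lerDr.
have xbl : x ^+ l.+1 <= b ^+ l.+1 by rewrite lerXn2r ?nnegrE // (le_trans x0).
have -> : r ^+ l.+1 = b ^+ l.+1 * expR h ^+ l.+1 by rewrite -exprMn.
by rewrite [leRHS]mulrCA; apply: ler_pM; rewrite ?exprn_ge0.
Qed.

Lemma p1_near (b e : R) : (\forall N \near \oo, (n N)%:R * p1 N <= b) -> 0 < e ->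
  \forall N \near \oo, p1 N <= e.
Proof.
move=> hb e0; near=> N.
have nb : (n N)%:R * p1 N <= b by near: N.
have [p00 [p01 _]] := hp N; have p10 : 0 <= p1 N by rewrite ltW // (le_lt_trans p00).
have nbig : (Num.truncn (`|b| / e)).+1%:R <= (n N)%:R :> R.
  by rewrite ler_nat; near: N; apply: n_near.
have h := lt_le_trans (truncnS_gt (`|b| / e)) nbig.
have n0 : 0 < (n N)%:R :> R by apply: le_lt_trans h; rewrite divr_ge0 // ltW.
rewrite -(ler_pM2l n0) (le_trans nb) // (le_trans (ler_norm b)) //.
by rewrite -ler_pdivrMr // ltW.
Unshelve. all: by end_near. Qed.

(** The level [c = 1] allows at most one cycle per component of the planted subgraph, and the outer
    base is then [lambda1 ^ 2 / lambda0] for every [k]. *)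
Lemma powerless_at_most_unicyclic (b : R) : b < 1 ->
  (\forall N \near \oo, (n N)%:R * p1 N <= b) ->
  (forall e, 0 < e ->
     \forall N \near \oo, ((n N)%:R * p1 N) ^+ 2 / (N%:R * p0 N) <= e) ->
  minimax_risk N (n N) (p0 N) (p1 N) @[N --> \oo] --> (1 : R).
Proof.
move=> b1 hb hr; pose b' := Num.max b (1 / 2).
have b'01 : 0 < b' < 1.
  by rewrite lt_max gt_max b1 divr_gt0 //= orbT /=; lra.
have [C C0 HC] := power4_geometric_sum_le b'01.
apply: (@asymptotic_core (fun _ _ => 1)) => [|e e0|e e0].
- by apply: p1_near hb _; lra.
- near=> N => S cS; have [p00 [p01 p1le1]] := hp N.
  apply: le_trans (overdense1_prob S p00 p01 p1le1) _; rewrite cS.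
  have p1e : p1 N <= e / (expR (1 / 2) * C).
    by near: N; apply: p1_near hb _; rewrite divr_gt0 ?mulr_gt0 ?expR_gt0.
  apply: (@le_trans _ _ (expR (1 / 2) * p1 N * C)).
    have p10 : 0 <= p1 N by rewrite ltW // (le_lt_trans p00).
    rewrite ler_wpM2l ?mulr_ge0 ?expR_ge0 //; apply: HC.
    rewrite mulr_ge0 //= le_max; apply/orP; left; by near: N.
  by rewrite mulrAC mulrC -ler_pdivlMr // mulr_gt0 ?expR_gt0.
- near=> N => k /andP[k0 kn] _; rewrite powRr1; last first.
    by rewrite mulr_ge0 // divr_ge0 ?sqr_ge0 //; case: (hp N).
  have p00 : 0 < p0 N by near: N; apply: p0_near.
  have N0 : (0 < N)%N by near: N; exists 1%N.
  have -> : (n N)%:R ^+ 2 / N%:R / k%:R * (p1 N ^+ 2 / p0 N * k%:R) =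
     ((n N)%:R * p1 N) ^+ 2 / (N%:R * p0 N) :> R.
    by field; rewrite !gt_eqF // ltr0n.
  by near: N; apply: hr.
Unshelve. all: by end_near. Qed.

Lemma powerless_case2 :
  (0%:E < limn_einf (fun N => (N%:R * p0 N)%:E))%E ->
  ((n N)%:R * p1 N @[N --> \oo] --> (0 : R)) ->
  minimax_risk N (n N) (p0 N) (p1 N) @[N --> \oo] --> (1 : R).
Proof.
move=> /limn_einf_near[a a0 ha] h1.
have near1 e : 0 < e -> \forall N \near \oo, (n N)%:R * p1 N <= e.
  exact: cvg0_near_le.
apply: (@powerless_at_most_unicyclic (1 / 2)); [lra|by apply: near1|].
move=> e e0; near=> N.
have [p00 [p01 _]] := hp N; have p10 : 0 <= p1 N by rewrite ltW // (le_lt_trans p00).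
have aN : a <= N%:R * p0 N by near: N.
have l1 : (n N)%:R * p1 N <= 1 by near: N; apply: near1.
have l2 : (n N)%:R * p1 N <= e * a by near: N; apply: near1; rewrite mulr_gt0.
rewrite ler_pdivrMr; last by apply: lt_le_trans aN.
apply: (@le_trans _ _ (e * a)); last by rewrite ler_wpM2l // ltW.
rewrite expr2; apply: le_trans l2; rewrite -[leRHS]mulr1 ler_wpM2l // mulr_ge0 //.
Unshelve. all: by end_near. Qed.

Lemma powerless_case3 :
  (N%:R * p0 N @[N --> \oo] --> +oo%R) ->
  (limn_esup (fun N => ((n N)%:R * p1 N)%:E) < 1%:E)%E ->
  minimax_risk N (n N) (p0 N) (p1 N) @[N --> \oo] --> (1 : R).
Proof.
move=> /cvgryPge h0 /limn_esup_near[b]; rewrite lte_fin => b1 hb.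
apply: (@powerless_at_most_unicyclic b) => // e e0; near=> N.
have [p00 [p01 _]] := hp N; have p10 : 0 <= p1 N by rewrite ltW // (le_lt_trans p00).
have aN : e^-1 <= N%:R * p0 N by near: N.
have l1 : (n N)%:R * p1 N <= 1 by apply: le_trans (ltW b1); near: N.
rewrite ler_pdivrMr; last by apply: lt_le_trans aN; rewrite invr_gt0.
apply: (@le_trans _ _ 1); first by rewrite exprn_ile1 // mulr_ge0.
by rewrite -ler_pdivrMl // mulr1.
Unshelve. all: by end_near. Qed.

End Asymptotics.

(** * First- and second-moment bases on the logarithmic scale *)

Section LogEstimates.
Variable R : realType.

Lemma mul_powR_le_expR (A x c e : R) : 0 < A -> 0 < x -> ln A + c * ln x <= e ->
  A * x `^ c <= expR e.
Proof.
move=> A0 x0 h; rewrite /powR gt_eqF // -{1}(lnK (_ : A \is Num.pos)) ?posrE //.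
by rewrite -expRD ler_expR.
Qed.

Variables (N n k : nat) (p0 p1 : R).
Hypotheses (k_gt0 : (0 < k)%N) (k_le : (k <= n)%N) (n_le : (n <= N)%N).
Hypotheses (p0_gt0 : 0 < p0) (p1_gt0 : 0 < p1).
Let kR : 0 < k%:R :> R. Proof. by rewrite ltr0n. Qed.
Let nR : 0 < n%:R :> R. Proof. by rewrite ltr0n (leq_trans k_gt0). Qed.
Let NR : 0 < N%:R :> R. Proof. by rewrite ltr0n (leq_trans k_gt0) // (leq_trans k_le). Qed.

Lemma first_moment_base_le (c e : R) :
  3 / 2 + (ln n%:R - ln k%:R) + c * (ln (n%:R * p1) - (ln n%:R - ln k%:R)) <= e ->
  expR (3 / 2) * (n%:R / k%:R) * (k%:R * p1) `^ c <= expR e.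
Proof.
move=> h; have nk : 0 < n%:R / k%:R :> R by rewrite divr_gt0.
apply: mul_powR_le_expR; rewrite ?mulr_gt0 ?invr_gt0 ?expR_gt0 //.
rewrite lnM ?posrE ?expR_gt0 // expRK; rewrite !(ln_div, lnM) ?posrE // in h *.
by apply: le_trans h; rewrite le_eqVlt; apply/orP; left; apply/eqP; ring.
Qed.

(** Expressed through [ln (n / k)], [ln (N / n)], [ln lambda0] and [ln lambda1], the quantities in
    which the assumptions of cases 1 and 4 are phrased. *)
Lemma overlap_base_le (c e : R) :
  (ln n%:R - ln k%:R) - (ln N%:R - ln n%:R) +
   c * (2 * ln (n%:R * p1) - ln (N%:R * p0) + (ln N%:R - ln n%:R) - (ln n%:R - ln k%:R)) <= e ->
  n%:R ^+ 2 / N%:R / k%:R * (p1 ^+ 2 / p0 * k%:R) `^ c <= expR e.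
Proof.
move=> h; apply: mul_powR_le_expR.
- by rewrite !divr_gt0 ?exprn_gt0.
- by rewrite mulr_gt0 // divr_gt0 ?exprn_gt0.
rewrite !(ln_div, lnM) ?posrE ?mulr_gt0 ?divr_gt0 ?invr_gt0 ?exprn_gt0 // in h *.
by apply: le_trans h; rewrite le_eqVlt; apply/orP; left; apply/eqP; ring.
Qed.

Lemma ln_nat_le : 0 <= ln (k%:R : R) <= ln (n%:R : R).
Proof. by rewrite ln_ge0 ?ler1n //= ler_ln ?posrE // ler_nat. Qed.

End LogEstimates.

(** * Case 1: vanishing average degrees *)

Section Case1.
Variables (R : realType) (n : nat -> nat) (p0 p1 : nat -> R).
Hypotheses (hp : forall N, 0 <= p0 N /\ p0 N < p1 N /\ p1 N <= 1)
    (hn : n @ \oo --> \oo)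
    (hnN : ((n N)%:R / N%:R : R) @[N --> \oo] --> (0 : R))
    (hp0 : N%:R ^+ 2 * p0 N @[N --> \oo] --> +oo%R)
    (hp1 : (n N)%:R ^+ 2 * p1 N @[N --> \oo] --> +oo%R)
    (hzeta : zeta N (n N) (p0 N) (p1 N) @[N --> \oo] --> (0 : R)).

(* The truncation level [c] = x / (x + 1) forbids components with more than
   about x + 1 vertices, where x is slightly above ln n / ln (1 / lambda1). *)
Lemma case1_first_moment (l k d b x c : R) : 0 < d < 1 -> 0 < b <= l -> 0 <= k <= l ->
  x = (1 + d) * l / b -> c = x / (x + 1) ->
  3 / 2 + (l - k) + c * (- b - (l - k)) <= 3 / 2 - d * b / 4.
Proof.
move=> /andP[d0 d1] /andP[b0 bl] /andP[k0 kl] xE cE0.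
have l0 : 0 < l by apply: lt_le_trans bl.
have x1 : 1 <= x by rewrite xE ler_pdivlMr // mul1r; nra.
have xb : x * b = (1 + d) * l by rewrite xE divfK // gt_eqF.
have y0 : 0 < (x + 1)^-1 by rewrite invr_gt0; lra.
have cE : c = 1 - (x + 1)^-1 by rewrite cE0; field; rewrite gt_eqF //; lra.
have E : 3 / 2 + (l - k) + c * (- b - (l - k)) =
   3 / 2 + (x + 1)^-1 * (l - k - x * b).
  by rewrite cE; field; rewrite gt_eqF //; lra.
rewrite E xb lerD2l.
have : (x + 1)^-1 * (l - k - (1 + d) * l) <= (x + 1)^-1 * (- d * l).
  by rewrite ler_pM2l //; lra.
move/le_trans; apply; rewrite mulrC ler_pdivrMr; last by lra.
have : b * x <= b * x * (2 - (1 + d)) + 2 * b * x * d by nra.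
nra.
Qed.

(** Here [l], [m], [k] stand for [ln n], [ln N] and the logarithm of the overlap, [a] and [b] for
    [- ln lambda0] and [- ln lambda1]. Multiplied by [x + 1], the exponent becomes
    [x a - m - 2 d l - k], and [x a <= (1 + d) (1 - d) m]; the remaining [- d ^ 2 m] dominates
    [(x + 1) E]. *)
Lemma case1_second_moment (l m k d a b E x c : R) : 0 < d < 1 -> 0 < b <= l -> l <= m ->
  0 <= k <= l -> 0 <= E -> 4 * E <= d ^+ 2 * b -> a * l <= (1 - d) * (b * m) ->
  x = (1 + d) * l / b -> c = x / (x + 1) ->
  (l - k) - (m - l) + c * (2 * (- b) - (- a) + (m - l) - (l - k)) <= - E.
Proof.
move=> /andP[d0 d1] /andP[b0 bl] lm /andP[k0 kl] E0 hE hab xE cE.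
have l0 : 0 < l by apply: lt_le_trans bl.
have x1 : 1 <= x by rewrite xE ler_pdivlMr // mul1r; nra.
have xb : x * b = (1 + d) * l by rewrite xE divfK // gt_eqF.
have xa : x * a <= (1 - d ^+ 2) * m.
  have -> : x * a = (1 + d) * (a * l) / b by rewrite xE; field; rewrite gt_eqF.
  rewrite ler_pdivrMr //.
  have : (1 + d) * (a * l) <= (1 + d) * ((1 - d) * (b * m)) by rewrite ler_pM2l //; lra.
  move/le_trans; apply; rewrite le_eqVlt; apply/orP; left; apply/eqP; ring.
have xE' : (x + 1) * E <= d ^+ 2 * m.
  have h1 : (x + 1) * E <= 2 * x * E by rewrite ler_wpM2r //; lra.
  apply: (le_trans h1); rewrite -(ler_pM2r b0).
  have -> : 2 * x * E * b = 2 * (x * b) * E by ring.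
  rewrite xb; have : (1 + d) * l * (4 * E) <= (1 + d) * l * (d ^+ 2 * b).
    by rewrite ler_wpM2l // mulr_ge0 //; lra.
  have : (1 + d) * l * (d ^+ 2 * b) <= 2 * m * (d ^+ 2 * b).
    by rewrite ler_wpM2r ?mulr_ge0 ?sqr_ge0 ?(ltW b0) //; nra.
  nra.
have y0 : 0 < (x + 1)^-1 by rewrite invr_gt0; lra.
have H : (l - k) - (m - l) + c * (2 * (- b) - (- a) + (m - l) - (l - k)) =
   (x + 1)^-1 * (x * a - 2 * (x * b) - k + 2 * l - m).
  by rewrite cE; field; rewrite gt_eqF //; lra.
rewrite H xb mulrC ler_pdivrMr; last by lra.
nra.
Qed.

Lemma powerless_case1 :
  (N%:R * p0 N @[N --> \oo] --> (0 : R)) -> ((n N)%:R * p1 N @[N --> \oo] --> (0 : R)) ->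
  (limn_esup (fun N => (rate_I (N%:R * p0 N) / rate_I ((n N)%:R * p1 N) *
             (ln (n N)%:R / ln N%:R))%:E) < 1%:E)%E ->
  minimax_risk N (n N) (p0 N) (p1 N) @[N --> \oo] --> (1 : R).
Proof.
move=> h0 h1 /limn_esup_near[beta0]; rewrite lte_fin => beta01 hbeta0.
pose beta := Num.max 0 beta0.
have beta1 : beta < 1 by rewrite gt_max beta01 ltr01.
have beta_ge0 : 0 <= beta by rewrite le_max lexx.
(* The gap [1 - beta] is [2 d]: one [d] pays for replacing the rates [I] by logarithms, the other
   remains as margin. *)
pose d := (1 - beta) / 2.
have d01 : 0 < d < 1 by apply/andP; rewrite /d; split; lra.
have [d0 d1] := andP d01.
pose l N : R := ln (n N)%:R; pose b N : R := - ln ((n N)%:R * p1 N).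
pose c N (k : nat) : R := ((1 + d) * l N / b N) / ((1 + d) * l N / b N + 1).
have near1 e : 0 < e -> \forall N \near \oo, (n N)%:R * p1 N <= e by exact: cvg0_near_le.
have pos : \forall N \near \oo, [/\ (0 < n N)%N, (n N <= N)%N, 0 < p0 N & 0 < p1 N].
  near=> N; have [n0 nN] : (0 < n N)%N /\ (n N <= N)%N by near: N; exact: (n_le_near hn hnN).
  have p00 : 0 < p0 N by near: N; exact: (p0_near hp hp0).
  by split => //; case: (hp N) => _ [/(lt_trans p00)].
have bbig M : \forall N \near \oo, M <= b N.
  near=> N; have [n0 _ _ p10] : [/\ (0 < n N)%N, (n N <= N)%N, 0 < p0 N & 0 < p1 N] by near: N.
  have l10 : 0 < (n N)%:R * p1 N by rewrite mulr_gt0 ?ltr0n.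
  rewrite /b lerNr -[leRHS]expRK ler_ln ?posrE ?expR_gt0 //.
  by near: N; apply: near1; rewrite expR_gt0.
(* [n ^ 2 p1 >= 1] means [- ln lambda1 <= ln n], which ensures [x >= 1] in the level [c]. *)
have bl : \forall N \near \oo, 0 < b N <= l N.
  near=> N; have [n0 _ _ p10] : [/\ (0 < n N)%N, (n N <= N)%N, 0 < p0 N & 0 < p1 N] by near: N.
  have nR : 0 < (n N)%:R :> R by rewrite ltr0n.
  have np : 1 <= (n N)%:R ^+ 2 * p1 N by near: N; move/cvgryPge: hp1; apply.
  apply/andP; split; first by apply: (@lt_le_trans _ _ 1) => //; near: N; apply: bbig.
  rewrite /b /l -subr_ge0 opprK -lnM ?posrE ?mulr_gt0 // mulrA -expr2 ln_ge0 //.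
have c_ge0 : \forall N \near \oo, forall k, 0 <= c N k.
  near=> N => k; have /andP[b0 bleq] : 0 < b N <= l N by near: N.
  have x0 : 0 <= (1 + d) * l N / b N.
    have lN0 : 0 <= l N by apply: le_trans bleq; apply: ltW.
    have d2 : 0 <= 1 + d by rewrite addr_ge0 // ltW.
    by rewrite divr_ge0 ?(ltW b0) // mulr_ge0.
  by rewrite divr_ge0 // addr_ge0.
apply: (asymptotic_core hp hn hnN hp0 hzeta (c := c)) => [|e e0|e e0].
- by apply: (p1_near hp hn (b := 1)); [apply: near1|lra].
- pose y := Num.min (1 / 2) (e / 2).
  have y0 : 0 < y by rewrite lt_min !divr_gt0.
  near=> N => S cS.
  have [n0 nN p00 p10] : [/\ (0 < n N)%N, (n N <= N)%N, 0 < p0 N & 0 < p1 N] by near: N.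
  have [p0_ge0 [p01 p1le1]] := hp N.
  have blN : 0 < b N <= l N by near: N.
  have cN : forall k, 0 <= c N k by near: N.
  have y12 : 0 <= y <= 1 / 2 by rewrite (ltW y0) ge_min lexx.
  have hy k : (0 < k <= #|S|)%N -> xpredT k ->
     expR (3 / 2) * (#|S|%:R / k%:R) * (k%:R * p1 N) `^ c N k <= y.
    rewrite cS => /andP[k0 kn] _; rewrite -[leRHS]lnK //.
    apply: first_moment_base_le => //.
    have := case1_first_moment d01 blN (ln_nat_le R k0 kn) erefl erefl.
    rewrite -/(c N k) -[ln (_ * p1 N)]opprK -/(b N) => /le_trans; apply.
    have : 4 / d * (3 / 2 - ln y) <= b N by near: N; apply: bbig.
    rewrite -(ler_pM2l d0) [d * (_ * _)]mulrA mulrCA divff ?gt_eqF // mulr1; lra.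
  apply: le_trans (overdense_prob_split p0_ge0 p01 p1le1 cN y12 hy) _.
  rewrite [X in _ + X](_ : _ = 0) ?addr0.
    by rewrite mulrC -ler_pdivlMr // ge_min lexx orbT.
  by rewrite /Pr big_pred0 // => G; apply/existsP => -[T]; rewrite andbF.
- pose E := Num.max 0 (- ln e).
  have E0 : 0 <= E by rewrite le_max lexx.
  near=> N => k /andP[k0 kn] _.
  have [n0 nN p00 p10] : [/\ (0 < n N)%N, (n N <= N)%N, 0 < p0 N & 0 < p1 N] by near: N.
  have blN : 0 < b N <= l N by near: N.
  have nR : 0 < (n N)%:R :> R by rewrite ltr0n.
  have NR : 0 < N%:R :> R by rewrite ltr0n (leq_trans n0).
  have l00 : 0 < N%:R * p0 N by rewrite mulr_gt0.
  have l10 : 0 < (n N)%:R * p1 N by rewrite mulr_gt0.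
  apply: (@le_trans _ _ (expR (- E))); last first.
    by rewrite -[leRHS]lnK // ler_expR lerNl le_max lexx orbT.
  apply: overlap_base_le => //.
  have lN : l N <= ln N%:R by rewrite ler_ln ?posrE // ler_nat.
  have hb : d * b N >= 1 by rewrite mulrC -ler_pdivrMr // ; near: N; apply: bbig.
  have hE : 4 * E <= d ^+ 2 * b N.
    by rewrite [leRHS]mulrC -ler_pdivrMr ?exprn_gt0 //; near: N; apply: bbig.
  have b1 : 1 < b N by apply: (@lt_le_trans _ _ 2); [lra|near: N; apply: bbig].
  have l11 : (n N)%:R * p1 N <= 1 by near: N; apply: near1.
  (* The limsup condition with [I] replaced by [- ln]: the term [- 1] in [I] at [lambda0] costs at
     most [ln N], which is below [d * b N * ln N]. *)
  have hab : - ln (N%:R * p0 N) * l N <= (1 - d) * (b N * ln N%:R).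
    have I1 : rate_I ((n N)%:R * p1 N) = (n N)%:R * p1 N - 1 + b N by [].
    have I1gt0 : 0 < rate_I ((n N)%:R * p1 N) by rewrite I1; lra.
    have lN0 : 0 < ln N%:R :> R by apply: lt_le_trans lN; case/andP: blN => /lt_le_trans; apply.
    have : rate_I (N%:R * p0 N) / rate_I ((n N)%:R * p1 N) * (ln (n N)%:R / ln N%:R) <= beta.
      by rewrite le_max; apply/orP; right; near: N.
    rewrite -/(l N) mulrACA -invfM ler_pdivrMr ?mulr_gt0 //.
    rewrite I1 /rate_I; move: (ln (N%:R * p0 N)) => a.
    have l_ge0 : 0 <= l N by case/andP: blN => /ltW b0; apply: le_trans.
    have : beta * (((n N)%:R * p1 N - 1 + b N) * ln N%:R) <= beta * (b N * ln N%:R).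
      by rewrite ler_wpM2l // ler_wpM2r ?(ltW lN0) //; lra.
    have : ln N%:R <= d * b N * ln N%:R by rewrite ler_peMl // ltW.
    have : 0 <= N%:R * p0 N * l N by rewrite mulr_ge0 // ltW.
    have -> : beta = 1 - 2 * d by rewrite /d; field.
    move: lN; set u := ln N%:R; set v := N%:R * p0 N; set w := (n N)%:R * p1 N.
    nra.
  have := case1_second_moment d01 blN lN (ln_nat_le R k0 kn) E0 hE hab erefl erefl.
  by rewrite -/(c N k) [- - ln (N%:R * _)]opprK /b [- - ln ((n N)%:R * _)]opprK.
Unshelve. all: by end_near. Qed.

End Case1.

(** * Case 4: polynomially growing average degree *)

Section Case4Finite.
Variable R : realType.

(** The margin [theta] is split: Chebyshev deviation [theta / 4], grid step about [theta / 4] times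
    the smallest size, and [theta / 2] left in the final level. At most [10 u / theta] grid points,
    each with a tail of order [u / #|S|], give [u ^ 2 / #|S|]. The lower bound on [#|S|] keeps the
    rounded step at least half its target. *)
Lemma grid_concentration (N : nat) (p0 p1 : R) (S : {set 'I_N}) (u theta q : R) :
  0 <= p0 -> p0 < p1 -> p1 <= 1 -> 0 < q <= 1 -> 0 < theta <= 1 -> 1 <= u ->
  8 / theta * u <= #|S|%:R ->
  (forall k, (k <= #|S|)%N -> #|S|%:R / u <= k%:R ->
     Ex (planted_law p0 p1 S) (fun G => (max_edges_in k S G)%:R) <= (1 - theta) / q * k%:R) ->
  Pr (planted_law p0 p1 S) (fun G => [exists T : {set 'I_N},
     [&& T \subset S, #|S|%:R / u <= #|T|%:R &
         (1 - theta / 2) / q * #|T|%:R < (edges_in G T)%:R]]) <=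
  10 * 16 / (theta ^+ 3 * q) * (u ^+ 2 / #|S|%:R).
Proof.
move=> p0_ge0 p01 p1_le1 /andP[q0 q1] /andP[t0 t1] u1 hu hm.
have u0 : 0 < u by apply: lt_le_trans u1.
have n0 : 0 < #|S|%:R :> R by apply: lt_le_trans hu; rewrite mulr_gt0 ?divr_gt0.
set kappa := #|S|%:R / u in hm *.
have kap0 : 0 < kappa by rewrite divr_gt0.
have kapn : kappa <= #|S|%:R by rewrite ler_pdivrMr // ler_peMr // ltW.
have kap8 : 2 <= theta / 4 * kappa.
  rewrite /kappa mulrA ler_pdivlMr //.
  have := ler_wpM2l (ltW t0) hu.
  have -> : theta * (8 / theta * u) = 8 * u by field; rewrite gt_eqF.
  lra.
have exK : exists k, kappa <= k%:R by exists #|S|.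
case: (ex_minnP exK) => K kapK Kmin.
have K0 : (0 < K)%N by rewrite -(ltr_nat R) (lt_le_trans kap0).
have KS : (K <= #|S|)%N by apply: Kmin.
pose s := Num.truncn (theta / 4 * kappa).
have tk0 : 0 <= theta / 4 * kappa by apply: le_trans kap8.
have sle : s%:R <= theta / 4 * kappa by rewrite truncn_le.
have slt : theta / 4 * kappa < s.+1%:R by exact: truncnS_gt.
have s2 : theta / 4 * kappa / 2 <= s%:R.
  have s1' : 1 < s.+1%:R :> R by apply: lt_trans slt; apply: lt_le_trans kap8; lra.
  have s1 : 1 <= s%:R :> R by move: s1'; rewrite ltr1n ltnS ler1n.
  by move: slt; rewrite -natr1; lra.
have s0 : (0 < s)%N by rewrite -(ltr_nat R); apply: lt_le_trans s2; lra.
have m0 : 0 <= (1 - theta) / q by rewrite divr_ge0 ?subr_ge0 // ltW.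
have d0 : 0 < theta / 4 by rewrite divr_gt0.
have hmK k : (K <= k <= #|S|)%N -> Ex (planted_law p0 p1 S)
    (fun G => (max_edges_in k S G)%:R) <= (1 - theta) / q * k%:R.
  by move=> /andP[Kk kS]; apply: hm => //; apply: le_trans kapK _; rewrite ler_nat.
have K0S : (0 < K <= #|S|)%N by rewrite K0 KS.
have H := dense_large_prob p0_ge0 p01 p1_le1 K0S s0 m0 d0 hmK.
have law0 G : 0 <= planted_law p0 p1 S G.
  apply: graph_law_ge0 => i j; have p10 := le_lt_trans p0_ge0 p01.
  by case: ifP => _; rewrite ?p0_ge0 ?p1_le1 ?(ltW p10) // (le_trans (ltW p01)).
apply: le_trans (le_trans H _).
  apply: Pr_sub => // G /existsP[T /and3P[TS kT W]]; apply/existsP; exists T.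
  rewrite TS Kmin //= (le_lt_trans _ W) //.
  have sT : s%:R <= theta / 4 * #|T|%:R.
    by apply: le_trans sle _; rewrite ler_wpM2l // ltW.
  have iq : 1 <= q^-1 by rewrite invf_ge1.
  have T0 : 0 <= #|T|%:R :> R by [].
  have h1 : (1 - theta) / q + theta / 4 <= (1 - 3 / 4 * theta) / q.
    have : theta * 1 <= theta * q^-1 by rewrite ler_pM2l.
    lra.
  apply: (@le_trans _ _ ((1 - 3 / 4 * theta) / q * ((1 + theta / 4) * #|T|%:R))).
    apply: ler_pM => //; first by rewrite addr_ge0 // ltW.
    by rewrite natrD; lra.
  rewrite mulrA ler_wpM2r //.
  have h2 : (1 - 3 / 4 * theta) * (1 + theta / 4) <= 1 - theta / 2.
    by have := sqr_ge0 theta; rewrite expr2; lra.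
  by rewrite mulrAC ler_pM2r ?invr_gt0.
have KR : 0 < K%:R :> R by rewrite ltr0n.
apply: (@le_trans _ _ ((10 / theta * u) * ((1 - theta) / q / ((theta / 4) ^+ 2 * kappa)))); last first.
  have -> : 10 / theta * u * ((1 - theta) / q / ((theta / 4) ^+ 2 * kappa)) =
     (1 - theta) * (10 * 16 / (theta ^+ 3 * q) * (u ^+ 2 / #|S|%:R)).
    by rewrite /kappa; field; rewrite !gt_eqF.
  apply: ler_piMl; last by lra.
  by rewrite mulr_ge0 // divr_ge0 ?exprn_ge0 ?mulr_ge0 ?exprn_ge0 // ltW.
apply: ler_pM => //.
- by rewrite divr_ge0 // mulr_ge0 ?exprn_ge0 ?(ltW d0).
- have ds : (#|S| %/ s)%:R <= 8 / theta * u.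
    apply: (@le_trans _ _ (#|S|%:R / s%:R)).
      by rewrite ler_pdivlMr ?ltr0n // -natrM ler_nat leq_trunc_div.
    rewrite ler_pdivrMr ?ltr0n //.
    apply: (@le_trans _ _ (8 / theta * u * (theta / 4 * kappa / 2))).
      rewrite /kappa le_eqVlt; apply/orP; left; apply/eqP; field.
      by rewrite !gt_eqF.
    by rewrite ler_wpM2l // mulr_ge0 ?divr_ge0 // ltW.
  have tu : 1 <= theta^-1 * u by rewrite -[leLHS]mulr1 ler_pM // ?invf_ge1.
  by rewrite -addn2 natrD; move: ds tu; move: (theta^-1) => i; lra.
- rewrite ler_wpM2l // lef_pV2 ?posrE ?mulr_gt0 ?exprn_gt0 ?invr_gt0 //.
  by rewrite ler_wpM2l // exprn_ge0 // ltW.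
Qed.

Lemma sqr_le_bin2 (m : nat) : (1 < m)%N -> (m * m <= 4 * 'C(m, 2))%N.
Proof.
move=> m1; have := bin_ffact m 2; rewrite -[2`!]/2%N ffactnS ffactn1.
rewrite -[(4 * _)%N]/(2 * 2 * _)%N -mulnA [(2 * 'C(m, 2))%N]mulnC => ->.
by case: m m1 => [|[|k]] // _; rewrite mulnCA leq_mul2l /=; lia.
Qed.

Lemma sqr_ln_le (L : R) : 1 <= L -> ln L ^+ 2 <= 4 * L.
Proof.
move=> L1; have L0 : 0 < L by apply: lt_le_trans L1.
set u := ln L; have u0 : 0 <= u by rewrite ln_ge0.
have -> : L = expR (u / 2) ^+ 2.
  by rewrite -expRM_natl mulrC divfK // /u lnK.
have := expR_ge1Dx (u / 2); move: (expR _) => y; nra.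
Qed.

(** With [v = ln (n / k)] the exponent is [3 / 2 - eps v + (1 + eps) l]: the excess of the level
    over 1 gains [eps v], and [v] exceeds [w = ln u_N]. *)
Lemma case4_sparse_first_moment (v l lam w eps e : R) : 0 < eps <= 1 -> w <= v ->
  l <= lam -> 0 <= lam -> 3 / 2 + 2 * lam - e <= eps * w ->
  3 / 2 + v + (1 + eps) * (l - v) <= e.
Proof.
move=> /andP[e0 e1] wv ll l0 h.
have h1 : eps * w <= eps * v by rewrite ler_pM2l.
have h2 : (1 + eps) * l <= (1 + eps) * lam by rewrite ler_wpM2l // addr_ge0 // ltW.
have h3 : eps * lam <= lam by rewrite ler_piMl.
have -> : 3 / 2 + v + (1 + eps) * (l - v) = 3 / 2 - eps * v + (1 + eps) * l by ring.
move: h h1 h2 h3; rewrite [(1 + eps) * lam]mulrDl mul1r.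
move: (eps * w) (eps * v) (_ * l) (eps * lam) => x y z t; clear; lra.
Qed.

(** The level [1 + eps] stays affordable because [(1 + eps) (1 - al) <= 1 - eps] once [2 eps <= al];
    this leaves [- eps L] against bounded terms. *)
Lemma case4_sparse_second_moment (v L l lam al eps E : R) : 0 < eps <= 1 -> 2 * eps <= al ->
  0 <= v -> 0 <= L -> l <= lam -> 0 <= lam -> 4 * lam + E <= eps * L ->
  v - L + (1 + eps) * (2 * l - al * L + L - v) <= - E.
Proof.
move=> /andP[e0 e1] ea v0 L0 ll l0 h.
have h1 : (1 + eps) * l <= (1 + eps) * lam by rewrite ler_wpM2l // addr_ge0 // ltW.
have h2 : eps * lam <= lam by rewrite ler_piMl.
have ea0 : 0 <= eps * al.
  by rewrite mulr_ge0 ?(ltW e0) // (le_trans _ ea) // mulr_ge0 // ltW.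
have h3 : (1 + eps) * (1 - al) * L <= (1 - eps) * L.
  rewrite ler_wpM2r // (_ : (1 + eps) * (1 - al) = 1 - al + eps - eps * al); last by ring.
  by move: ea ea0; move: (eps * al) => x; clear; lra.
have h4 : 0 <= eps * v by rewrite mulr_ge0 // ltW.
have -> : v - L + (1 + eps) * (2 * l - al * L + L - v) =
  2 * ((1 + eps) * l) + (1 + eps) * (1 - al) * L - L - eps * v by ring.
move: h h1 h2 h3 h4; rewrite [(1 + eps) * lam]mulrDl mul1r [(1 - eps) * L]mulrBl mul1r.
by move: (_ * l) (eps * lam) (_ * (1 - al) * L) (eps * L) (eps * v) => x y z t w; clear; lra.
Qed.

(** With [q = 1 - alpha] the terms in [L] sum to [- (theta / 2) L]; one half absorbs [v], the other
    the bounded contribution of [lambda1]. *)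
Lemma case4_dense_second_moment (v L u l lam q q0 theta E : R) : 0 < q0 -> q0 <= q -> q <= 1 ->
  0 < theta <= 1 -> 0 <= v -> v <= u -> l <= lam -> 0 <= lam -> u <= theta / 4 * L ->
  2 * lam / q0 + E <= theta / 4 * L ->
  v - L + (1 - theta / 2) / q * (2 * l - (1 - q) * L + L - v) <= - E.
Proof.
move=> q00 qq q1 /andP[t0 t1] v0 vu ll l0 h1 h2.
have q_gt0 : 0 < q by apply: lt_le_trans qq.
have -> : v - L + (1 - theta / 2) / q * (2 * l - (1 - q) * L + L - v) =
   v - 2 * (theta / 4 * L) + (1 - theta / 2) / q * (2 * l - v) by field; rewrite gt_eqF.
have c0 : 0 <= (1 - theta / 2) / q by rewrite divr_ge0 ?(ltW q_gt0) //; lra.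
have c1 : (1 - theta / 2) / q <= q0^-1.
  rewrite ler_pdivrMr // -(ler_pM2l q00) mulrA mulfV ?gt_eqF // mul1r.
  by apply: le_trans qq; rewrite ler_piMr ?(ltW q00) //; lra.
have h3 : (1 - theta / 2) / q * (2 * l - v) <= (1 - theta / 2) / q * (2 * lam).
  by rewrite ler_wpM2l //; lra.
have h4 : (1 - theta / 2) / q * (2 * lam) <= q0^-1 * (2 * lam).
  by rewrite ler_wpM2r // mulr_ge0.
move: vu h1 h2 h3 h4; rewrite (mulrC (2 * lam)).
by move: (theta / 4 * L) (_ * (2 * l - v)) (_ / q * (2 * lam)) (_ * (2 * lam)) => x y z t; clear; lra.
Qed.

End Case4Finite.

Section Case4.
Variables (R : realType) (n : nat -> nat) (p0 p1 : nat -> R) (S : forall N : nat, {set 'I_N}).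
Hypotheses (hp : forall N, 0 <= p0 N /\ p0 N < p1 N /\ p1 N <= 1)
    (hS : \forall N \near \oo, #|S N| = n N)
    (hn : n @ \oo --> \oo)
    (hnN : ((n N)%:R / N%:R : R) @[N --> \oo] --> (0 : R))
    (hnlog : ((n N)%:R / ln N%:R : R) @[N --> \oo] --> +oo%R)
    (hp0 : N%:R ^+ 2 * p0 N @[N --> \oo] --> +oo%R)
    (hzeta : zeta N (n N) (p0 N) (p1 N) @[N --> \oo] --> (0 : R)).

Lemma powerless_case4 :
  (0%:E < limn_einf (fun N => (log_ratio_exponent N (n N) (p0 N))%:E))%E ->
  (limn_esup (fun N => (log_ratio_exponent N (n N) (p0 N))%:E) < 1%:E)%E ->
  (limn_esup (fun N => ((1 - log_ratio_exponent N (n N) (p0 N)) *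
             sup_mean_max_edges (n N) (p0 N) (p1 N) (S N))%:E) < 1%:E)%E ->
  minimax_risk N (n N) (p0 N) (p1 N) @[N --> \oo] --> (1 : R).
Proof.
set al := fun N => log_ratio_exponent N (n N) (p0 N).
move=> /limn_einf_near[a0 a0_gt0 ha0] /limn_esup_near[a1]; rewrite lte_fin => a1_lt1 ha1.
move=> /limn_esup_near[b4]; rewrite lte_fin => b4_lt1 hb4.
(* Eventually [(1 - alpha)] times the supremum is at most [b4 <= 1 - theta]; the minimum keeps
   [theta <= 1] even for negative [b4]. *)
pose theta := Num.min (1 / 2) (1 - b4).
have theta01 : 0 < theta <= 1.
  by rewrite lt_min ge_min subr_gt0 b4_lt1 divr_gt0 //= ; apply/orP; left; lra.
have thetab : b4 <= 1 - theta.
  have : theta <= 1 - b4 by rewrite ge_min lexx orbT.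
  lra.
have [theta0 theta1] := andP theta01.
pose eps := Num.min a0 1 / 2.
have eps01 : 0 < eps <= 1.
  apply/andP; split; first by rewrite divr_gt0 // lt_min a0_gt0 ltr01.
  have : Num.min a0 1 <= 1 by rewrite ge_min lexx orbT.
  rewrite /eps; lra.
have epsa : 2 * eps <= a0 by rewrite /eps mulrC divfK // ge_min lexx.
have [eps0 eps1] := andP eps01.
pose q0 := 1 - a1; have q0_gt0 : 0 < q0 by rewrite subr_gt0.
pose Lam := Num.max 1 (4 / q0).
have Lam1 : 1 <= Lam by rewrite le_max lexx.
pose lam := ln Lam; have lam0 : 0 <= lam by rewrite ln_ge0.
pose L N : R := ln N%:R - ln (n N)%:R.
pose u N : R := loglog_ratio R N (n N).
pose c N (k : nat) : R :=
  if (n N)%:R / u N <= k%:R then (1 - theta / 2) / (1 - al N) else 1 + eps.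
have pos : \forall N \near \oo, [/\ (0 < n N)%N, (n N <= N)%N, 0 < p0 N & 0 < p1 N].
  near=> N; have [n0 nN] : (0 < n N)%N /\ (n N <= N)%N by near: N; exact: (n_le_near hn hnN).
  have p00 : 0 < p0 N by near: N; exact: (p0_near hp hp0).
  by split => //; case: (hp N) => _ [/(lt_trans p00)].
have LE : \forall N \near \oo, ln (Defs.ratio R N (n N)) = L N.
  near=> N; have [n0 nN _ _] : [/\ (0 < n N)%N, (n N <= N)%N, 0 < p0 N & 0 < p1 N] by near: N.
  by rewrite /Defs.ratio ln_div // posrE ltr0n // (leq_trans n0).
have Lbig M : \forall N \near \oo, M <= L N.
  near=> N; have [n0 nN _ _] : [/\ (0 < n N)%N, (n N <= N)%N, 0 < p0 N & 0 < p1 N] by near: N.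
  have nR : 0 < (n N)%:R :> R by rewrite ltr0n.
  have NR : 0 < N%:R :> R by rewrite ltr0n (leq_trans n0).
  rewrite -lerN2 -[leRHS]expRK /L opprB -ln_div // ler_ln ?posrE ?divr_gt0 ?expR_gt0 //.
  by near: N; apply: cvg0_near_le => //; rewrite expR_gt0.
have uE : \forall N \near \oo, u N = ln (L N).
  by near=> N; rewrite /u /loglog_ratio; congr ln; near: N.
have ubig M : \forall N \near \oo, M <= u N.
  near=> N; have -> : u N = ln (L N) by near: N.
  have LM : expR M <= L N by near: N; apply: Lbig.
  by rewrite -[leLHS]expRK ler_ln ?posrE ?expR_gt0 // (lt_le_trans (expR_gt0 M)).
have lnubig M : \forall N \near \oo, M <= ln (u N).
  near=> N; have LM : expR M <= u N by near: N; apply: ubig.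
  by rewrite -[leLHS]expRK ler_ln ?posrE ?expR_gt0 // (lt_le_trans (expR_gt0 M)).
have u2L : \forall N \near \oo, u N ^+ 2 <= 4 * L N.
  near=> N; have -> : u N = ln (L N) by near: N.
  by apply: sqr_ln_le; near: N; apply: Lbig.
(* [u_N ^ 2 <= 4 ln (N / n) <= 4 ln N], and [ln N] is small against [n]: this beats the error of
   [grid_concentration]. *)
have u2n e : 0 < e -> \forall N \near \oo, u N ^+ 2 / (n N)%:R <= e.
  move=> e0; near=> N.
  have [n0 nN _ _] : [/\ (0 < n N)%N, (n N <= N)%N, 0 < p0 N & 0 < p1 N] by near: N.
  have nR : 0 < (n N)%:R :> R by rewrite ltr0n.
  have h1 : u N ^+ 2 <= 4 * L N by near: N.
  have ln0 : 0 <= ln (n N)%:R :> R by rewrite ln_ge0 // ler1n.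
  have L1 : 1 <= L N by near: N; apply: Lbig.
  have lnN : 0 < ln N%:R :> R by move: L1; rewrite /L; lra.
  have h2 : 4 / e <= (n N)%:R / ln N%:R by near: N; move/cvgryPge: hnlog; apply.
  rewrite ler_pdivrMr // (le_trans h1) //.
  move: h2; rewrite ler_pdivlMr // mulrAC ler_pdivrMr // [_ * e]mulrC.
  apply: le_trans; rewrite ler_pM2l // /L; lra.
have un e : 0 < e -> \forall N \near \oo, u N <= e * (n N)%:R.
  move=> e0; near=> N.
  have [n0 nN _ _] : [/\ (0 < n N)%N, (n N <= N)%N, 0 < p0 N & 0 < p1 N] by near: N.
  have nR : 0 < (n N)%:R :> R by rewrite ltr0n.
  have h1 : u N ^+ 2 / (n N)%:R <= e by near: N; apply: u2n.
  have u1 : 1 <= u N by near: N; apply: ubig.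
  rewrite ler_pdivrMr // in h1; apply: le_trans h1; rewrite expr2 ler_peMl //.
  exact: le_trans u1.
have alE : \forall N \near \oo, [/\ a0 <= al N, al N <= a1 & ln (N%:R * p0 N) = al N * L N].
  near=> N; have L1 : 1 <= L N by near: N; apply: Lbig.
  split; [by near: N|by near: N|].
  have LN : ln (Defs.ratio R N (n N)) = L N by near: N.
  by rewrite /al /log_ratio_exponent LN divfK // gt_eqF // (lt_le_trans _ L1).
have hmean : \forall N \near \oo, forall (A : {set 'I_N}) k, #|A| = n N -> (k <= n N)%N ->
    (n N)%:R / u N <= k%:R ->
    Ex (planted_law (p0 N) (p1 N) A) (fun G => (max_edges_in k A G)%:R) <=
    (1 - theta) / (1 - al N) * k%:R.
  near=> N => A k cA kn kap.
  have [n0 nN _ _] : [/\ (0 < n N)%N, (n N <= N)%N, 0 < p0 N & 0 < p1 N] by near: N.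
  have nR : 0 < (n N)%:R :> R by rewrite ltr0n.
  have u1 : 1 <= u N by near: N; apply: ubig.
  have [_ alN _] : [/\ a0 <= al N, al N <= a1 & ln (N%:R * p0 N) = al N * L N] by near: N.
  have q_gt0 : 0 < 1 - al N by rewrite subr_gt0 (le_lt_trans alN).
  have cS : #|S N| = n N by near: N.
  have k0 : 0 < k%:R :> R.
    by apply: lt_le_trans kap; rewrite divr_gt0 // (lt_le_trans _ u1).
  rewrite (@Ex_max_edges_card _ _ _ _ _ _ (S N)); last by rewrite cA cS.
  rewrite -ler_pdivrMr //.
  apply: (@le_trans _ _ (sup_mean_max_edges (n N) (p0 N) (p1 N) (S N))).
    have kn1 : (k < (n N).+1)%N by [].
    exact: (le_bigmax_cond 0 (fun k : 'I_(n N).+1 =>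
      Ex (planted_law (p0 N) (p1 N) (S N)) (fun G => (max_edges_in k (S N) G)%:R) / k%:R)
      (j := Ordinal kn1)).
  rewrite ler_pdivlMr // mulrC; apply: le_trans thetab; near: N.
  exact: hb4.
(* The term [k = n] of the supremum is the mean number of edges in [S] divided by [n], so it bounds
   [lambda1]; the 4 comes from [n ^ 2 <= 4 'C(n, 2)]. *)
have lam1 : \forall N \near \oo, (n N)%:R * p1 N <= Lam.
  near=> N.
  have [_ nN _ p10] : [/\ (0 < n N)%N, (n N <= N)%N, 0 < p0 N & 0 < p1 N] by near: N.
  have n2 : (2 <= n N)%N by near: N; apply: n_near.
  have nR : 0 < (n N)%:R :> R by rewrite ltr0n ltnW.
  have u1 : 1 <= u N by near: N; apply: ubig.
  have [_ alN _] : [/\ a0 <= al N, al N <= a1 & ln (N%:R * p0 N) = al N * L N] by near: N.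
  have q_gt0 : 0 < 1 - al N by rewrite subr_gt0 (le_lt_trans alN).
  have cS : #|S N| = n N by near: N.
  have nun : (n N)%:R / u N <= (n N)%:R.
    by rewrite ler_pdivrMr ?(lt_le_trans _ u1) // ler_peMr // ltW.
  have hm : forall (A : {set 'I_N}) k, #|A| = n N -> (k <= n N)%N ->
    (n N)%:R / u N <= k%:R ->
    Ex (planted_law (p0 N) (p1 N) A) (fun G => (max_edges_in k A G)%:R) <=
    (1 - theta) / (1 - al N) * k%:R by near: N; exact: hmean.
  have := hm (S N) (n N) cS (leqnn _) nun.
  have -> : Ex (planted_law (p0 N) (p1 N) (S N)) (fun G => (max_edges_in (n N) (S N) G)%:R) =
     p1 N * 'C(n N, 2)%:R.
    rewrite -cS -(Ex_edges_in (p0 N)); apply: eq_bigr => G _.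
    by rewrite max_edges_in_all.
  have C2 : (n N)%:R * (n N)%:R <= 4 * 'C(n N, 2)%:R :> R.
    by rewrite -!natrM ler_nat sqr_le_bin2.
  have m1 : (1 - theta) / (1 - al N) <= q0^-1.
    rewrite ler_pdivrMr // -(ler_pM2l q0_gt0) mulrA mulfV ?gt_eqF // mul1r /q0.
    have : q0 * (1 - theta) <= q0 by rewrite ler_piMr ?(ltW q0_gt0) //; lra.
    by rewrite /q0; lra.
  move=> hC; apply: (@le_trans _ _ (4 / q0)); last by rewrite le_max lexx orbT.
  rewrite -(ler_pM2r nR).
  have h1 : (1 - theta) / (1 - al N) * (n N)%:R <= q0^-1 * (n N)%:R by rewrite ler_pM2r.
  have h2 : p1 N * ((n N)%:R * (n N)%:R) <= p1 N * (4 * 'C(n N, 2)%:R) by rewrite ler_pM2l.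
  by move: h2 hC h1; move: ('C(_, _)%:R) (q0^-1) => C i; lra.
apply: (asymptotic_core hp hn hnN hp0 hzeta (c := c)) => [|e e0|e e0].
- by apply: (p1_near hp hn lam1); lra.
- pose y := Num.min (1 / 2) (e / 4).
  have y0 : 0 < y by rewrite lt_min !divr_gt0.
  have y12 : 0 <= y <= 1 / 2 by rewrite (ltW y0) ge_min lexx.
  have ye : 2 * y <= e / 2.
    have : y <= e / 4 by rewrite ge_min lexx orbT.
    lra.
  pose B := 10 * 16 / (theta ^+ 3 * q0).
  have B0 : 0 < B.
    have T3 : 0 < theta ^+ 3 * q0 by rewrite mulr_gt0 ?exprn_gt0.
    by rewrite divr_gt0.
  have eB : 0 < B^-1 * (e / 2) by apply: mulr_gt0; [rewrite invr_gt0|rewrite divr_gt0].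
  near=> N => A cA.
  have [n0 nN p00 p10] : [/\ (0 < n N)%N, (n N <= N)%N, 0 < p0 N & 0 < p1 N] by near: N.
  have [p0_ge0 [p01 p1le1]] := hp N.
  have nR : 0 < (n N)%:R :> R by rewrite ltr0n.
  have u1 : 1 <= u N by near: N; apply: ubig.
  have u0 : 0 < u N by apply: lt_le_trans u1.
  have [al0 al1 _] : [/\ a0 <= al N, al N <= a1 & ln (N%:R * p0 N) = al N * L N] by near: N.
  have qq : q0 <= 1 - al N by rewrite /q0; lra.
  have q_gt0 : 0 < 1 - al N by apply: lt_le_trans qq.
  have q_le1 : 1 - al N <= 1 by move: a0_gt0 al0; lra.
  have l1 : (n N)%:R * p1 N <= Lam by near: N; exact: lam1.
  have c_ge0 k : 0 <= c N k.
    rewrite /c; case: ifP => _; first by rewrite divr_ge0 ?(ltW q_gt0) //; lra.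
    by rewrite addr_ge0 // ltW.
  have hy k : (0 < k <= #|A|)%N -> k%:R < (n N)%:R / u N ->
     expR (3 / 2) * (#|A|%:R / k%:R) * (k%:R * p1 N) `^ c N k <= y.
    rewrite cA => /andP[k0 kn] kk; rewrite -[leRHS]lnK //.
    have kR : 0 < k%:R :> R by rewrite ltr0n.
    have -> : c N k = 1 + eps by rewrite /c leNgt kk.
    apply: first_moment_base_le => //.
    have vw : ln (u N) <= ln (n N)%:R - ln k%:R.
      rewrite -ln_div ?posrE // ler_ln ?posrE ?divr_gt0 //.
      by rewrite ler_pdivlMr // mulrC -ler_pdivlMr // ltW.
    have ll : ln ((n N)%:R * p1 N) <= lam.
      by rewrite ler_ln ?posrE ?mulr_gt0 // (lt_le_trans ltr01).
    apply: (case4_sparse_first_moment eps01 vw ll lam0).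
    by rewrite [leRHS]mulrC -ler_pdivrMr //; near: N; apply: lnubig.
  apply: le_trans (overdense_prob_split (P := fun k => k%:R < (n N)%:R / u N)
    p0_ge0 p01 p1le1 c_ge0 y12 hy) _.
  have -> : e = e / 2 + e / 2 by rewrite -splitr.
  apply: lerD => //.
  have hm k : (k <= #|A|)%N -> #|A|%:R / u N <= k%:R ->
     Ex (planted_law (p0 N) (p1 N) A) (fun G => (max_edges_in k A G)%:R) <=
     (1 - theta) / (1 - al N) * k%:R.
    rewrite cA; move: k.
    suff H : forall (A' : {set 'I_N}) k, #|A'| = n N -> (k <= n N)%N ->
      (n N)%:R / u N <= k%:R ->
      Ex (planted_law (p0 N) (p1 N) A') (fun G => (max_edges_in k A' G)%:R) <=
      (1 - theta) / (1 - al N) * k%:R by move=> k; apply: H.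
    by near: N; exact: hmean.
  have hu : 8 / theta * u N <= #|A|%:R.
    rewrite cA -ler_pdivlMl ?divr_gt0 //; near: N; apply: un.
    by rewrite invr_gt0 divr_gt0.
  have q01 : 0 < 1 - al N <= 1 by rewrite q_gt0.
  apply: le_trans (le_trans (grid_concentration p0_ge0 p01 p1le1 q01 theta01 u1 hu hm) _).
    have p1_0 := ltW p10.
    apply: Pr_sub => [G|G /existsP[T /and3P[TS kT W]]].
      apply: graph_law_ge0 => i j.
      by case: ifP => _; rewrite ?p0_ge0 ?p1le1 ?p1_0 // (le_trans (ltW p01)).
    apply/existsP; exists T; rewrite -leNgt in kT.
    by move: W; rewrite /c kT TS cA kT.
  have iq : (theta ^+ 3 * (1 - al N))^-1 <= (theta ^+ 3 * q0)^-1.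
    by rewrite lef_pV2 ?posrE ?mulr_gt0 ?exprn_gt0 // ler_pM2l // exprn_gt0.
  rewrite cA; apply: (@le_trans _ _ (B * (u N ^+ 2 / (n N)%:R))).
    rewrite ler_wpM2r ?divr_ge0 ?sqr_ge0 // /B.
    by apply: ler_wpM2l.
  by rewrite -ler_pdivlMl //; near: N; exact: u2n.
- pose E := Num.max 0 (- ln e).
  have E0 : 0 <= E by rewrite le_max lexx.
  near=> N => k /andP[k0 kn] _.
  have [n0 nN p00 p10] : [/\ (0 < n N)%N, (n N <= N)%N, 0 < p0 N & 0 < p1 N] by near: N.
  have nR : 0 < (n N)%:R :> R by rewrite ltr0n.
  have kR : 0 < k%:R :> R by rewrite ltr0n.
  have NR : 0 < N%:R :> R by rewrite ltr0n (leq_trans n0).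
  have u1 : 1 <= u N by near: N; apply: ubig.
  have u0 : 0 < u N by apply: lt_le_trans u1.
  have L1 : 1 <= L N by near: N; apply: Lbig.
  have [al0 al1 lE] : [/\ a0 <= al N, al N <= a1 & ln (N%:R * p0 N) = al N * L N] by near: N.
  have l1 : (n N)%:R * p1 N <= Lam by near: N; exact: lam1.
  have ll : ln ((n N)%:R * p1 N) <= lam.
    by rewrite ler_ln ?posrE ?mulr_gt0 // (lt_le_trans ltr01).
  have v0 : 0 <= ln (n N)%:R - ln k%:R :> R.
    by rewrite subr_ge0 ler_ln ?posrE // ler_nat.
  apply: (@le_trans _ _ (expR (- E))); last first.
    by rewrite -[leRHS]lnK // ler_expR lerNl le_max lexx orbT.
  apply: overlap_base_le => //.
  rewrite -/(L N) lE /c; case: ifP => [kk|_].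
    have E1 : al N = 1 - (1 - al N) by rewrite opprB addrC subrK.
    rewrite {2}E1.
    apply: (@case4_dense_second_moment _ _ _ (u N) _ lam _ q0) => //.
    - by rewrite /q0; lra.
    - by move: a0_gt0 al0; lra.
    - rewrite -ln_div ?posrE //; apply: (@le_trans _ _ (ln (u N))).
        rewrite ler_ln ?posrE ?divr_gt0 // ler_pdivrMr // mulrC -ler_pdivrMr //.
      by have := expR_ge1Dx (ln (u N)); rewrite lnK ?posrE //; lra.
    - have h1 : u N ^+ 2 <= 4 * L N by near: N.
      have h2 : 16 / theta <= u N by near: N; apply: ubig.
      rewrite -(ler_pM2r u0) -expr2; apply: (le_trans h1).
      have := ler_wpM2l (_ : 0 <= theta / 4 * L N) h2.
      have -> : theta / 4 * L N * (16 / theta) = 4 * L N by field; rewrite gt_eqF.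
      by apply; rewrite mulr_ge0 ?divr_ge0 ?(ltW theta0) // (le_trans _ L1).
    - rewrite [leRHS]mulrC -ler_pdivrMr ?divr_gt0 //; near: N; exact: Lbig.
  apply: (@case4_sparse_second_moment _ _ _ _ lam) => //.
  - exact: le_trans al0.
  - exact: le_trans L1.
  - by rewrite [leRHS]mulrC -ler_pdivrMr //; near: N; apply: Lbig.
Unshelve. all: by end_near. Qed.

End Case4.

Theorem theorem4 (R : realType) (n : nat -> nat) (p0 p1 : nat -> R)
    (S : forall N : nat, {set 'I_N})
    (hp : forall N, 0 <= p0 N /\ p0 N < p1 N /\ p1 N <= 1)
    (hS : \forall N \near \oo, #|S N| = n N)
    (hn : n @ \oo --> \oo)
    (hnN : ((n N)%:R / N%:R : R) @[N --> \oo] --> (0 : R))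
    (hnlog : ((n N)%:R / ln N%:R : R) @[N --> \oo] --> +oo%R)
    (hp0 : N%:R ^+ 2 * p0 N @[N --> \oo] --> +oo%R)
    (hp1 : (n N)%:R ^+ 2 * p1 N @[N --> \oo] --> +oo%R)
    (hzeta : zeta N (n N) (p0 N) (p1 N) @[N --> \oo] --> (0 : R)) :
  let lambda0 (N : nat) : R := N%:R * p0 N in
  let lambda1 (N : nat) : R := (n N)%:R * p1 N in
  let alpha (N : nat) : R := log_ratio_exponent N (n N) (p0 N) in
  [\/ [/\ lambda0 @ \oo --> (0 : R), lambda1 @ \oo --> (0 : R) &
          (limn_esup (fun N => (rate_I (lambda0 N) / rate_I (lambda1 N) *
             (ln (n N)%:R / ln N%:R))%:E) < 1%:E)%E],
      [/\ (0%:E < limn_einf (fun N => (lambda0 N)%:E))%E,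
          (limn_esup (fun N => (lambda0 N)%:E) < +oo)%E &
          lambda1 @ \oo --> (0 : R)],
      [/\ lambda0 @ \oo --> +oo%R, alpha @ \oo --> (0 : R) &
          (limn_esup (fun N => (lambda1 N)%:E) < 1%:E)%E] |
      [/\ (0%:E < limn_einf (fun N => (alpha N)%:E))%E,
          (limn_esup (fun N => (alpha N)%:E) < 1%:E)%E &
          (limn_esup (fun N => ((1 - alpha N) *
             sup_mean_max_edges (n N) (p0 N) (p1 N) (S N))%:E) < 1%:E)%E]] ->
  minimax_risk N (n N) (p0 N) (p1 N) @[N --> \oo] --> (1 : R).
Proof.
move=> lambda0 lambda1 alpha [[]|[]|[]|[]].
- exact: (powerless_case1 hp hn hnN hp0 hp1 hzeta).
- by move=> h0 _ h1; exact: (powerless_case2 hp hn hnN hp0 hzeta h0 h1).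
- by move=> h0 _ h1; exact: (powerless_case3 hp hn hnN hp0 hzeta h0 h1).
- exact: (powerless_case4 hp hS hn hnN hnlog hp0 hzeta).
Qed.
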